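(* Let $d\ge 1$ and $k\ge 2$ be integers. (1) For any $s\ge 0$, the map $\mathbf{A}\mapsto P(\mathbf{A},s)$ is continuous on $\mathcal{A}_{d,k}$. (2) The map $\mathbf{A}\mapsto s(\mathbf{A})$ is continuous on $\mathcal{A}^C_{d,k}$. (3) Moreover, the map $(\mathbf{A},s)\mapsto P(\mathbf{A},s)$ is continuous at each point $(\mathbf{A},s)\in\mathcal{A}_{d,k}\times[0,\infty)$ with $\mathbf{A}\in\mathcal{G}_{d,k}$ or $s\notin\{0,1,\ldots,d-1\}$.
   Context: $\mathcal{A}_{d,k}$ is the set of $k$-tuples $\mathbf{A}=(A_1,\ldots,A_k)$ of real $d\times d$ matrices (with its usual topology as a finite-dimensional space); $\mathcal{A}^C_{d,k}$ is the subset of those with $\|A_i\|<1$ for all $i$ (Euclidean operator norm); $\mathcal{G}_{d,k}$ is the subset of those with all $A_i\in GL_d(\mathbb{R})$. For $A\in\mathbb{R}^{d\times d}$ let $\alpha_1(A)\ge\cdots\ge\alpha_d(A)$ be its singular values. The singular value function is $\phi^s(A)=\alpha_1(A)\cdots\alpha_m(A)\,\alpha_{m+1}(A)^{s-m}$ with $m=\lfloor s\rfloor$ for $0\le s\le d$ (so $\phi^d(A)=|\det A|$), with the convention $0^0=1$, and $\phi^s(A)=|\det(A)|^{s/d}$ for $s>d$. It is sub-multiplicative. For $\mathbf{A}\in\mathcal{A}_{d,k}$ and $s\ge 0$, $$P(\mathbf{A},s)=\lim_{n\to\infty}\frac1n\log\Big(\sum_{|\mathbf{i}|=n}\phi^s(A_{\mathbf{i}})\Big)\in[-\infty,\infty),$$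 where the sum is over all words $\mathbf{i}=i_1\cdots i_n$ over $\{1,\ldots,k\}$ and $A_{\mathbf{i}}=A_{i_1}\cdots A_{i_n}$; the limit exists and equals the infimum over $n$ by sub-multiplicativity. Continuity of $P$ is with respect to the usual topology on $[-\infty,\infty)$. For $\mathbf{A}\in\mathcal{A}^C_{d,k}$, the singularity dimension is $s(\mathbf{A})=\inf\{s\ge 0:P(\mathbf{A},s)\le 0\}$. *)

(* Defs.v *)
From mathcomp Require Import all_boot all_order all_algebra.
From mathcomp Require Import all_classical all_reals all_analysis.
From mathcomp Require Import polyrcf.
Import Order.TTheory GRing.Theory Num.Theory.
Import numFieldNormedType.Exports.

Set Implicit Arguments.
Unset Strict Implicit.
Unset Printing Implicit Defensive.

Local Open Scope classical_set_scope.
Local Open Scope ring_scope.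

(* [prod_topology] carries the product topology of the entrywise topology of
   ['M[R]_d], i.e. the usual topology of the finite-dimensional space. *)
Notation mxtuple R d k := {ptws 'I_k -> 'M[R]_d}.

Definition enorm (R : realType) (n : nat) (v : 'cV[R]_n) : R :=
  Num.sqrt (\sum_i v i ord0 ^+ 2).

Definition opnorm (R : realType) (d : nat) (A : 'M[R]_d) : R :=
  sup [set enorm (A *m v) | v in [set v : 'cV[R]_d | enorm v <= 1]].

(* Square roots of the eigenvalues of [A^T *m A], repeated according to their
   algebraic multiplicity.  [rootsR] lists the distinct real roots in increasing
   order, whence the [rev]. *)
Definition singular_values (R : realType) (d : nat) (A : 'M[R]_d) : seq R :=
  let p := char_poly (A^T *m A) in
  rev [seq Num.sqrt x | x <- flatten [seq nseq (mup x p) x | x <- rootsR p]].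

(* Indexed from 0: [sing_val A i] is the (i+1)-st largest singular value. *)
Definition sing_val (R : realType) (d : nat) (A : 'M[R]_d) (i : nat) : R :=
  nth 0 (singular_values A) i.

(* [powR 0 0 = 1].  When [s = d], [sing_val A d] is a default value, but it is
   raised to the power 0.  Only meant for [0 <= s], where [Num.truncn s] is the
   integer part of [s]. *)
Definition svf (R : realType) (d : nat) (s : R) (A : 'M[R]_d) : R :=
  let m := Num.truncn s in
  if s <= d%:R then (\prod_(i < m) sing_val A i) * (sing_val A m) `^ (s - m%:R)
  else `|\det A| `^ (s / d%:R).

Definition word_prod (R : realType) (d k n : nat) (A : mxtuple R d k)
  (w : n.-tuple 'I_k) : 'M[R]_d := \prod_(i <- w) A i.

Definition partition_sum (R : realType) (d k : nat) (A : mxtuple R d k) (s : R)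
  (n : nat) : R := \sum_(w : n.-tuple 'I_k) svf s (word_prod A w).

(* [lne 0 = -oo] *)
Definition pressure (R : realType) (d k : nat) (A : mxtuple R d k) (s : R) :
    \bar R :=
  limn (fun n : nat => ((n%:R^-1)%:E * lne (partition_sum A s n)%:E)%E).

Definition contractive (R : realType) (d k : nat) : set (mxtuple R d k) :=
  [set A | forall i, opnorm (A i) < 1].

Definition invertible (R : realType) (d k : nat) : set (mxtuple R d k) :=
  [set A | forall i, A i \in unitmx].

Definition singularity_dim (R : realType) (d k : nat) (A : mxtuple R d k) : R :=
  inf [set s : R | 0 <= s /\ (pressure A s <= 0)%E].

(* Main.v *)
Require Import Defs.
From mathcomp Require Import all_boot all_order all_algebra fingroup perm.
From mathcomp Require Import all_classical all_reals all_analysis.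
From mathcomp Require Import polyrcf spectral complex lra ring.
Import Order.TTheory GRing.Theory Num.Theory.
Import numFieldNormedType.Exports.

(** Why the theorem is true.

    Let [rho s A] be the exponential of the pressure: the exponential growth rate
    of the sum of [svf s] over the words of length [n]. Everything is proved for
    [rho], and [lne] transports it to the pressure, the value [-oo] included
    ([cvg_lne], [cvg_lne_growth]).

    For a fixed exponent, [rho] is upper semicontinuous, being an infimum of
    continuous functions by Fekete's lemma. Lower semicontinuity is the heart of
    the matter, and follows Morris' approach through Bochi's inequality. Suppose
    first that [svf s] is, up to constants, the [p]-th power of the norm of
    [T A], where [T] is multiplicative with values in the matrices of size [D]
    ([rep_norm]). If [r] exceeds the growth rate, then [block_bound] says
<<
      S ((D + 1) n) <= C r ^ n (S n) ^ D,    S n = sum of |T A_w| ^ p over |w| = n,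
>>
    where [C] depends only on [D] and [p]. Indeed there is a quasi-norm [F] whose
    sum over the images of a vector under the words of length [n] is at most
    [2 * r ^+ n] times its value at the vector ([extremal_contraction]). In a basis
    adapted to [F] ([adapted_frame]) the entries on and below the diagonal
    contribute at most [r ^+ n], up to a constant; and an entry of a product of
    [D.+1] matrices of size [D] is a sum over paths, each of which visits such an
    entry. The inequality involves two word lengths only, so it survives small
    perturbations of the matrices; a growth rate that dropped in the limit would
    contradict it for large [n] ([growth_cvg]).

    The function [svf s] has this form when [s] is rational: the product of the [m]
    largest singular values is the norm of the [m]-th compound matrix up to a
    constant ([minor_norm_sing_val]), and for a fractional part with denominator [b]
    one takes the [b]-th root of the norm of a Kronecker product of [b] compounds
    ([svf_representable]). For [s > d] it is a power of the determinant.

    The other exponents are reached by comparison. Increasing [s] by [h] multiplies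
    [rho] by at most [c `^ h], locally uniformly ([rho_le]), so joint continuity at
    a point [(A, s)] follows from continuity at rational exponents together with
    continuity of [rho] in [s] at the fixed tuple [A] ([rho_joint_cvg]). The latter
    holds because [rho] is convex in [s] between consecutive integers up to [d], and
    beyond [d] ([growth_convex], [rho_left], [rho_right]). Convexity says nothing
    about the right of an integer below [d]; there, invertibility provides a lower
    bound on the smallest singular values ([rho_right_invertible]).

    Finally, for contractive tuples [rho] decreases in [s], strictly where it is
    positive, so the point where it crosses 1 depends continuously on the tuple
    ([singularity_dim_cvg]). *)

Set Implicit Arguments.
Unset Strict Implicit.
Unset Printing Implicit Defensive.

Local Open Scope classical_set_scope.
Local Open Scope ring_scope.

(** * Real powers *)

Section Powers.
Variable R : realType.

Lemma powRD_nneg (a x y : R) : 0 <= x -> 0 <= y -> a `^ (x + y) = a `^ x * a `^ y.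
Proof.
move=> x0 y0; have [xy|xy] := eqVneq (x + y) 0; last first.
  by rewrite powRD// (negbTE xy).
move: xy => /eqP; rewrite paddr_eq0// => /andP[/eqP-> /eqP->].
by rewrite addr0 powRr0 mulr1.
Qed.

Lemma powRX (a x : R) n : 0 <= a -> (a `^ x) ^+ n = (a ^+ n) `^ x.
Proof. by move=> a0; rewrite -powR_mulrn ?powR_ge0// powRAC powR_mulrn. Qed.

Lemma powR_prodl (I : Type) (r : seq I) (a : I -> R) (x : R) : (forall i, 0 <= a i) ->
  (\prod_(i <- r) a i) `^ x = \prod_(i <- r) a i `^ x.
Proof.
move=> a0; elim: r => [|i r IH]; first by rewrite !big_nil powR1.
by rewrite !big_cons powRM ?prodr_ge0// IH.
Qed.

Lemma powR_sumr (I : Type) (r : seq I) (a : R) (x : I -> R) : (forall i, 0 <= x i) ->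
  a `^ (\sum_(i <- r) x i) = \prod_(i <- r) a `^ x i.
Proof.
move=> x0; elim: r => [|i r IH]; first by rewrite !big_nil powRr0.
by rewrite !big_cons powRD_nneg ?sumr_ge0// IH.
Qed.

(** The weighted inequality between the geometric and arithmetic means. *)
Lemma young (x y l : R) : 0 <= x -> 0 <= y -> 0 < l < 1 ->
  x `^ l * y `^ (1 - l) <= l * x + (1 - l) * y.
Proof.
move=> x0 y0 /andP[l0 l1]; have l1' : 0 < 1 - l by rewrite subr_gt0.
have := @conjugate_powR R (x `^ l) (y `^ (1 - l)) l^-1 (1 - l)^-1.
rewrite !powR_ge0 !invr_gt0 l0 l1' !invrK => /(_ isT isT isT isT).
rewrite -!powRrM !divff ?gt_eqF// !powRr1// [x * l]mulrC [y * _]mulrC.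
by apply; rewrite subrKC.
Qed.

Lemma ge0_powR_le (a b x : R) : 0 <= x -> 0 <= a -> a <= b -> a `^ x <= b `^ x.
Proof.
move=> x0 a0 ab; rewrite ge0_ler_powR ?nnegrE//; exact: le_trans ab.
Qed.

Lemma le_powR (p a b : R) : 0 < p -> 0 <= a -> a <= b -> a `^ p <= b `^ p.
Proof. by move=> /ltW; exact: ge0_powR_le. Qed.

Lemma powR_rootK (x : R) n : 0 <= x -> (0 < n)%N -> (x `^ n%:R^-1) ^+ n = x.
Proof.
move=> x0 n0; rewrite -powR_mulrn ?powR_ge0// -powRrM mulVf ?powRr1//.
by rewrite pnatr_eq0 -lt0n.
Qed.

(** Holds for [p < 1] as well: each [x i] is at most the [p]-th root of the sum
    of the [p]-th powers. *)
Lemma powR_sum_le (I : finType) (p : R) (x : I -> R) : 0 < p ->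
  (forall i, 0 <= x i) ->
  (\sum_i x i) `^ p <= (#|I|%:R `^ p) * \sum_i x i `^ p.
Proof.
move=> p0 x0; set S := \sum_i x i `^ p.
have S0 : 0 <= S by apply: sumr_ge0 => i _; exact: powR_ge0.
have xS i : x i <= S `^ p^-1.
  rewrite -[leLHS]powRr1// -[X in x i `^ X](mulfV (lt0r_neq0 p0)) powRrM.
  rewrite ge0_ler_powR ?nnegrE ?powR_ge0 ?invr_ge0 ?(ltW p0)//.
  by rewrite /S (bigD1 i)//= lerDl sumr_ge0// => j _; exact: powR_ge0.
have -> : S = (S `^ p^-1) `^ p.
  by rewrite -powRrM mulVf ?powRr1// lt0r_neq0.
rewrite -powRM ?powR_ge0 ?ler0n//.
rewrite ge0_ler_powR ?nnegrE ?(ltW p0) ?sumr_ge0 ?mulr_ge0 ?powR_ge0//.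
by rewrite (le_trans (ler_sum _ (fun i _ => xS i)))// sumr_const mulr_natl.
Qed.

Lemma powRD_le (p a b : R) : 0 < p -> 0 <= a -> 0 <= b ->
  (a + b) `^ p <= 2 `^ p * (a `^ p + b `^ p).
Proof.
move=> p0 a0 b0.
have := @powR_sum_le bool p (fun i => if i then a else b) p0.
by rewrite !big_bool card_bool; apply; case.
Qed.

(** The limit may be 0, where [powR] is not given by [expR] and [ln]. *)
Lemma cvg_powR (T : Type) (F : set_system T) (f : T -> R) (l p : R) : Filter F ->
  0 < p -> 0 <= l -> (forall x, 0 <= f x) -> f x @[x --> F] --> l ->
  f x `^ p @[x --> F] --> l `^ p.
Proof.
move=> FF p0; rewrite le_eqVlt => /predU1P[<-|l0] f0 fl; last first.
  have fpos : \forall x \near F, 0 < f x by exact: (cvgr_gt _ fl).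
  have -> : l `^ p = expR (p * ln l) by rewrite /powR gt_eqF.
  apply: (@cvg_trans _ (expR (p * ln (f x)) @[x --> F])).
    apply: near_eq_cvg; apply: filterS fpos => x x0.
    by rewrite /powR gt_eqF.
  apply: (cvg_comp _ expR _ (@continuous_expR R _)).
  by apply: cvgM; [exact: cvg_cst|exact: (cvg_comp _ _ fl (continuous_ln l0))].
rewrite powR0 ?gt_eqF//; apply/cvgrPdist_lt => e e0.
have fe : \forall x \near F, f x < e `^ p^-1.
  by apply: (cvgr_lt _ fl); rewrite powR_gt0.
apply: filterS fe => x xe; rewrite sub0r normrN ger0_norm ?powR_ge0//.
have <- : (e `^ p^-1) `^ p = e by rewrite -powRrM mulVf ?gt_eqF// powRr1// ltW.
by rewrite gt0_ltr_powR// nnegrE ?powR_ge0.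
Qed.

(** The factor [c `^ h] is close to 1, uniformly for small [h] of either sign. *)
Lemma powR_near1 (c x y : R) : 0 < c -> 0 <= x -> x < y ->
  exists2 dl, 0 < dl & forall h, `|h| <= dl -> c `^ h * x <= y.
Proof.
move=> c0; rewrite le_eqVlt => /predU1P[<- y0|x0 xy].
  by exists 1 => // h _; rewrite mulr0 ltW.
have y0 : 0 < y by exact: lt_trans xy.
have lxy : 0 < ln (y / x) by rewrite ln_gt0// ltr_pdivlMr// mul1r.
have cp : 0 < `|ln c| + 1 by rewrite ltr_wpDl.
exists (ln (y / x) / (`|ln c| + 1)) => [|h hd]; first by rewrite divr_gt0.
rewrite -ler_pdivlMr// -[leRHS]lnK ?posrE ?divr_gt0// /powR gt_eqF// ler_expR.
rewrite (le_trans (ler_norm _))// normrM.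
move: hd; rewrite ler_pdivlMr// => /(le_trans _); apply.
by rewrite ler_wpM2l// lerDl.
Qed.

(** Otherwise [(x / y) ^+ n] would grow at least linearly, by Bernoulli's
    inequality. *)
Lemma exp_le_base (x y K : R) : 0 <= x -> 0 < y ->
  (forall n, (0 < n)%N -> x ^+ n <= K * y ^+ n) -> x <= y.
Proof.
move=> x0 y0 xy; rewrite leNgt; apply/negP => lt.
have z1 : 1 < x / y by rewrite ltr_pdivlMr// mul1r.
have K0 : 0 <= K.
  have := xy _ (ltn0Sn 0); rewrite !expr1 => h.
  by rewrite -(pmulr_lge0 _ y0) (le_trans x0).
have {xy}zK n : (0 < n)%N -> (x / y) ^+ n <= K.
  by move=> n0; rewrite expr_div_n ler_pdivrMr ?exprn_gt0// xy.
have bern n : 1 + n%:R * (x / y - 1) <= (x / y) ^+ n.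
  elim: n => [|n IH]; first by rewrite mul0r addr0 expr0.
  rewrite exprS (le_trans _ (ler_wpM2l _ IH)) ?(ltW (lt_trans ltr01 z1))//.
  rewrite -natr1; set z := x / y in z1 *.
  have : 0 <= n%:R * (z - 1) ^+ 2 by rewrite mulr_ge0// sqr_ge0.
  rewrite expr2; nra.
pose n := (Num.truncn (K / (x / y - 1))).+1.
have := zK n (ltn0Sn _); apply/negP; rewrite -ltNge (lt_le_trans _ (bern n))//.
rewrite ltr_pwDl// -ler_pdivrMr ?subr_gt0// ltW// truncnS_gt//.
Qed.

End Powers.

(** * Growth rates of sequences *)

Section Growth.
Variable R : realType.
Implicit Types (Z W : nat -> R) (r : R).

Definition exp_bounded Z r :=
  exists2 C, 0 < C & forall n, Z n <= C * r ^+ n.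

(** The limit of the [n]-th roots of [Z n] for a quasi-submultiplicative [Z].
    Unlike the roots themselves, this form is insensitive to constant factors. *)
Definition growth Z : R := inf [set r | 0 < r /\ exp_bounded Z r].

Lemma growth_ge0 Z : 0 <= growth Z.
Proof.
by rewrite /growth; have [->|/set0P ne] := eqVneq [set r | 0 < r /\ exp_bounded Z r] set0;
  rewrite ?inf0 //; apply: lb_le_inf => // r [/ltW].
Qed.

Lemma growth_le Z r : 0 < r -> exp_bounded Z r -> growth Z <= r.
Proof.
move=> r0 Zr; apply: ge_inf => //=.
by exists 0 => x [/ltW].
Qed.

Lemma growth_lt Z r0 r : 0 < r0 -> exp_bounded Z r0 ->
  growth Z < r -> exp_bounded Z r.
Proof.
move=> r0_gt0 Zr0 /inf_lt => /(_ (ex_intro _ r0 (conj r0_gt0 Zr0))).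
move=> [x [x0 [C C0 ZC]] xr]; exists C => // n.
by rewrite (le_trans (ZC n))// ler_pM2l// lerXn2r ?nnegrE ?ltW// (lt_trans x0).
Qed.

Lemma growth_leM Z W C a r0 : 0 < C -> 0 < a -> 0 < r0 -> exp_bounded W r0 ->
  (forall n, Z n <= C * a ^+ n * W n) -> growth Z <= a * growth W.
Proof.
move=> C0 a0 r00 Wr0 ZW; rewrite leNgt; apply/negP; rewrite -ltr_pdivlMl// => lt.
have [r /andP[Wr rZ]] : exists r, growth W < r < a^-1 * growth Z.
  by exists ((growth W + a^-1 * growth Z) / 2); rewrite !midf_lt.
have r_gt0 : 0 < r by rewrite (le_lt_trans (growth_ge0 W)).
have [C' C'0 WC] := growth_lt r00 Wr0 Wr.
suff: growth Z <= a * r by rewrite leNgt -ltr_pdivlMl// rZ.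
apply: growth_le; first exact: mulr_gt0.
exists (C * C'); first exact: mulr_gt0.
move=> n; rewrite (le_trans (ZW n))// exprMn mulrACA ler_pM2l ?WC//.
by rewrite mulr_gt0// exprn_gt0.
Qed.

Definition quasi_submult Z K :=
  [/\ 0 < K, forall n, 0 <= Z n & forall m n, Z (m + n)%N <= K * Z m * Z n].

Lemma quasi_submult_exp_bounded Z K : quasi_submult Z K ->
  exists2 r, 0 < r & exp_bounded Z r.
Proof.
move=> [K0 Z0 ZM]; have r0 : 0 < K * Z 1%N + 1.
  by rewrite ltr_wpDl// mulr_ge0// ltW.
exists (K * Z 1%N + 1) => //; exists (Z 0%N + 1) => [|n]; first by rewrite ltr_wpDl.
elim: n => [|n IH]; first by rewrite expr0 mulr1 lerDl.
rewrite -add1n (le_trans (ZM _ _))// exprD expr1 mulrCA.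
by rewrite ler_pM// ?lerDl// mulr_ge0// ltW.
Qed.

(** Fekete's lemma up to a constant: if [K * Z n] were smaller than
    [growth Z ^+ n], cutting [m] into blocks of length [n] would bound [Z m] by an
    exponential of smaller base. *)
Lemma growth_fekete Z K : quasi_submult Z K ->
  forall n, (0 < n)%N -> growth Z ^+ n <= K * Z n.
Proof.
move=> [K0 Z0 ZM] n n0; rewrite leNgt; apply/negP => lt.
set g := growth Z in lt; set y := K * Z n in lt.
have y0 : 0 <= y by rewrite mulr_ge0// ltW.
have g0 : 0 < g.
  rewrite lt_neqAle growth_ge0 andbT; apply/eqP => g0.
  by move: lt; rewrite -g0 expr0n gtn_eqF//= ltNge y0.
have rootK : (y `^ n%:R^-1) ^+ n = y by exact: powR_rootK.
pose r := Num.max (g / 2) (y `^ n%:R^-1).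
have r0 : 0 < r by rewrite lt_max divr_gt0.
have rg : r < g.
  rewrite gt_max ltr_pdivrMr// mulr2n mulrDr mulr1 ltrDl g0/=.
  rewrite ltNge; apply/negP => /(lerXn2r n); rewrite !nnegrE powR_ge0 ltW//.
  by move=> /(_ isT isT); rewrite rootK leNgt lt.
have yr : y <= r ^+ n.
  rewrite -[leLHS]rootK lerXn2r ?nnegrE ?powR_ge0//; first exact: ltW.
  by rewrite le_max lexx orbT.
suff: g <= r by rewrite leNgt rg.
apply: growth_le => //.
(* [C] absorbs the incomplete block, of length [m %% n]. *)
pose C := \sum_(j < n) Z j / r ^+ j + 1.
have C0 : 0 < C.
  by rewrite ltr_wpDl// sumr_ge0// => j _; rewrite divr_ge0// exprn_ge0// ltW.
exists C => // m; elim/ltn_ind: m => m IH.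
have [mn|nm] := ltnP m n.
  rewrite -ler_pdivrMr ?exprn_gt0// /C (bigD1 (Ordinal mn))//= -addrA lerDl.
  rewrite addr_ge0// sumr_ge0// => j _; rewrite divr_ge0// exprn_ge0//.
  exact: ltW.
rewrite -{1}(subnKC nm) (le_trans (ZM _ _))// -/y.
rewrite -[in leRHS](subnKC nm) exprD mulrCA ler_pM ?IH//.
by rewrite ltn_subrL n0 (leq_trans n0 nm).
Qed.

Lemma growth_eqM Z W C C' r0 : 0 < C -> 0 < C' -> 0 < r0 -> exp_bounded W r0 ->
  (forall n, Z n <= C * W n) -> (forall n, W n <= C' * Z n) ->
  growth Z = growth W.
Proof.
move=> C0 C'0 r00 Wr0 ZW WZ.
have Zr0 : exp_bounded Z r0.
  case: Wr0 => D D0 WD; exists (C * D) => [|n]; first exact: mulr_gt0.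
  by rewrite (le_trans (ZW n))// -mulrA ler_pM2l.
apply/eqP; rewrite eq_le; apply/andP; split; rewrite -[leRHS]mul1r.
  by apply: (growth_leM C0 _ r00 Wr0) => // n; rewrite expr1n mulr1.
by apply: (growth_leM C'0 _ r00 Zr0) => // n; rewrite expr1n mulr1.
Qed.

End Growth.

Section LogLimit.
Variable R : realType.
Implicit Types (Z : nat -> R).

(** Since [lne 0] is [-oo], the limit [0] is allowed. *)
Lemma cvg_lne (T : Type) (F : set_system T) {FF : Filter F} (u : T -> R) (l : R) :
  0 <= l -> u x @[x --> F] --> l -> lne (u x)%:E @[x --> F] --> lne l%:E.
Proof.
rewrite le_eqVlt => /predU1P[<-|l0] ul.
  rewrite /lne lexx; apply/cvgeNyPle => A.
  have : \forall x \near F, u x < expR A by apply: (cvgr_lt _ ul); exact: expR_gt0.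
  apply: filterS => x uA; rewrite /lne; case: ifPn => [_|]; first exact: leNye.
  rewrite -ltNge => ux0; rewrite lee_fin -[leRHS]expRK ler_ln ?posrE ?expR_gt0//.
  exact: ltW.
rewrite lne_EFin//.
have u0 : \forall x \near F, 0 < u x by exact: (cvgr_gt _ ul).
apply/fine_cvgP; split.
  by apply: filterS u0 => x x0; rewrite lne_EFin.
apply: (@cvg_trans _ (ln (u x) @[x --> F])).
  by apply: near_eq_cvg; apply: filterS u0 => x x0; rewrite /= lt_geF.
exact: (cvg_comp _ _ ul (continuous_ln l0)).
Qed.

Lemma near_lne_growth_le Z r b : 0 < r -> exp_bounded Z r -> ln r < b ->
  \forall n \near \oo, ((n%:R^-1)%:E * lne (Z n)%:E <= b%:E)%E.
Proof.
move=> r0 [C C0 ZC] rb; have br0 : 0 < b - ln r by rewrite subr_gt0.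
near=> n; have n0 : 0 < (n%:R : R).
  by rewrite ltr0n; near: n; exists 1%N.
rewrite /lne; case: ifPn => [_|].
  by rewrite gt0_muleNy ?leNye// lte_fin invr_gt0.
rewrite -ltNge => Zn0; rewrite -EFinM lee_fin ler_pdivrMl//.
have Crn : 0 < C * r ^+ n by rewrite mulr_gt0// exprn_gt0.
have : ln (Z n) <= ln C + n%:R * ln r.
  rewrite mulr_natl -lnXn// -lnM ?posrE ?exprn_gt0//.
  by rewrite ler_ln ?posrE.
move/le_trans; apply; rewrite -lerBrDr -mulrBr -ler_pdivrMr//.
by near: n; exact: nbhs_infty_ger.
Unshelve. all: by end_near. Qed.

(** The lower bound is [growth_fekete], with an error [ln K / n]; a growth rate
    [0] corresponds to the limit [-oo]. *)
Lemma cvg_lne_growth Z K : quasi_submult Z K ->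
  ((n%:R^-1)%:E * lne (Z n)%:E)%E @[n --> \oo] --> lne (growth Z)%:E.
Proof.
move=> ZK; have [r0 r0_gt0 Zr0] := quasi_submult_exp_bounded ZK.
have [gle|g0] := lerP (growth Z) 0.
  have -> : growth Z = 0 by apply/eqP; rewrite eq_le gle growth_ge0.
  rewrite {2}/lne lexx; apply/cvgeNyPle => A.
  apply: (@near_lne_growth_le _ (expR (A - 1))).
  - exact: expR_gt0.
  - by apply: (growth_lt r0_gt0 Zr0); rewrite (le_lt_trans gle)// expR_gt0.
  - by rewrite expRK ltrBlDr ltrDl.
have [K0 Z0 ZM] := ZK.
have Zpos n : (0 < n)%N -> 0 < Z n.
  move=> n0; rewrite -(pmulr_rgt0 _ K0).
  by rewrite (lt_le_trans _ (growth_fekete ZK n0))// exprn_gt0.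
rewrite lne_EFin//; set g := growth Z in g0 *.
have lneE n : (0 < n)%N ->
    ((n%:R^-1)%:E * lne (Z n)%:E = (n%:R^-1 * ln (Z n))%:E)%E.
  by move=> n0; rewrite lne_EFin ?Zpos.
apply: (@cvg_trans _ ((n%:R^-1 * ln (Z n))%:E @[n --> \oo])).
  by apply: near_eq_cvg; exists 1%N => // n /= n0; rewrite lneE.
apply: cvg_EFin; first by near=> n.
apply/cvgrPdist_le => /= e e0.
have up : \forall n \near \oo, ((n%:R^-1)%:E * lne (Z n)%:E <= (ln g + e)%:E)%E.
  apply: (@near_lne_growth_le _ (expR (ln g + e / 2))).
  - exact: expR_gt0.
  - apply: (growth_lt r0_gt0 Zr0); rewrite -/g -{1}(lnK g0).
    by rewrite ltr_expR ltrDl divr_gt0.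
  - by rewrite expRK ltrD2l ltr_pdivrMr// ltr_pMr// ltr1n.
near=> n; have n0 : (0 < n)%N by near: n; exists 1%N.
have nR0 : 0 < (n%:R : R) by rewrite ltr0n.
rewrite ler_distlC; apply/andP; split.
  rewrite ler_pdivlMl//.
  have : n%:R * ln g <= ln K + ln (Z n).
    rewrite mulr_natl -lnXn// -lnM ?posrE ?Zpos//.
    by rewrite ler_ln ?posrE ?exprn_gt0 ?mulr_gt0 ?Zpos// growth_fekete.
  rewrite -lerBlDl; apply: le_trans; rewrite mulrBr lerD2l lerN2.
  by rewrite -ler_pdivrMr//; near: n; exact: nbhs_infty_ger.
by rewrite -lee_fin -lneE//; near: n.
Unshelve. all: by end_near. Qed.

End LogLimit.

(** * Entrywise norms and sums over words *)

Section L1.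
Variable R : realType.

(** The sum of the moduli of the entries is exactly submultiplicative, and
    multiplicative under Kronecker products. *)
Definition l1 m n (M : 'M[R]_(m, n)) : R := \sum_i \sum_j `|M i j|.

Lemma l1_ge0 m n (M : 'M[R]_(m, n)) : 0 <= l1 M.
Proof. by do 2![apply: sumr_ge0 => ? _]. Qed.

Lemma l1_entry m n (M : 'M[R]_(m, n)) i j : `|M i j| <= l1 M.
Proof.
rewrite /l1 (bigD1 i)//= (bigD1 j)//= -addrA lerDl.
by rewrite addr_ge0 ?sumr_ge0// => k _; rewrite sumr_ge0.
Qed.

Lemma l1D m n (M N : 'M[R]_(m, n)) : l1 (M + N) <= l1 M + l1 N.
Proof.
rewrite -big_split/=; apply: ler_sum => i _.
by rewrite -big_split/=; apply: ler_sum => j _; rewrite mxE ler_normD.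
Qed.

Lemma l1Z m n (c : R) (M : 'M[R]_(m, n)) : l1 (c *: M) = `|c| * l1 M.
Proof.
rewrite mulr_sumr; apply: eq_bigr => i _; rewrite mulr_sumr.
by apply: eq_bigr => j _; rewrite mxE normrM.
Qed.

Lemma l1_0 m n : l1 (0 : 'M[R]_(m, n)) = 0.
Proof. by rewrite -(scale0r 0) l1Z normr0 mul0r. Qed.

Lemma l1_mul m n q (M : 'M[R]_(m, n)) (N : 'M[R]_(n, q)) :
  l1 (M *m N) <= l1 M * l1 N.
Proof.
rewrite mulr_suml; apply: ler_sum => i _; rewrite mulr_suml.
under [leLHS]eq_bigr do rewrite mxE.
apply: (@le_trans _ _ (\sum_j \sum_k `|M i k| * `|N k j|)).
  apply: ler_sum => j _; rewrite (le_trans (ler_norm_sum _ _ _))//.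
  by apply: ler_sum => k _; rewrite normrM.
rewrite exchange_big; apply: ler_sum => k _; rewrite -mulr_sumr ler_wpM2l//.
by rewrite /l1 [leRHS](bigD1 k)//= lerDl; do 2![apply: sumr_ge0 => ? _].
Qed.

Lemma l1_col n (v : 'cV[R]_n) : l1 v = \sum_i `|v i 0|.
Proof. by apply: eq_bigr => i _; rewrite big_ord1. Qed.

Lemma l1_col_mx m n q (M : 'M[R]_(m, q)) (N : 'M[R]_(n, q)) :
  l1 (col_mx M N) = l1 M + l1 N.
Proof.
rewrite /l1 big_split_ord/=; congr (_ + _); apply: eq_bigr => i _;
  by apply: eq_bigr => j _; rewrite ?col_mxEu ?col_mxEd.
Qed.

End L1.

Section WordSums.
Variables (R : realType) (K : finType) (D : nat).
Implicit Types (B : K -> 'M[R]_D) (g h : 'M[R]_D -> R).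

(** [g] is applied to the whole product, so that [wsumD] can cut the words into
    blocks. *)
Definition wsum B n g : R := \sum_(w : n.-tuple K) g (\prod_(i <- w) B i).

Lemma wsum0 B g : wsum B 0 g = g 1%:M.
Proof.
rewrite /wsum (eq_bigr (fun=> g 1%:M)) => [|w _]; last by rewrite tuple0 big_nil.
by rewrite sumr_const card_tuple expn0.
Qed.

Lemma wsumS B n g :
  wsum B n.+1 g = \sum_i wsum B n (fun X => g (B i *m X)).
Proof.
rewrite /wsum pair_big/= (reindex (fun q => cons_tuple q.1 q.2))/=.
  by apply: eq_bigr => -[i w] _; rewrite big_cons.
exists (fun w => (thead w, behead_tuple w)) => [[i w]|w] _ /=.
  by congr (_, _); apply: val_inj.
by apply: val_inj; case: w => -[].
Qed.

Lemma wsum1 B g : wsum B 1 g = \sum_i g (B i).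
Proof. by rewrite wsumS; apply: eq_bigr => i _; rewrite wsum0 mulmx1. Qed.

Lemma wsumD B m n g :
  wsum B (m + n) g = wsum B m (fun X => wsum B n (fun Y => g (X *m Y))).
Proof.
elim: m g => [|m IH] g.
  by rewrite wsum0; apply: eq_bigr => w _; rewrite mul1mx.
rewrite addSn !wsumS; apply: eq_bigr => i _; rewrite IH.
by apply: eq_bigr => w _; apply: eq_bigr => w' _; rewrite mulmxA.
Qed.

Lemma wsum_ge0 B n g : (forall X, 0 <= g X) -> 0 <= wsum B n g.
Proof. by move=> g0; apply: sumr_ge0. Qed.

Lemma wsum_le B n g h : (forall X, g X <= h X) -> wsum B n g <= wsum B n h.
Proof. by move=> gh; apply: ler_sum. Qed.

Lemma wsumZ B n c g : wsum B n (fun X => c * g X) = c * wsum B n g.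
Proof. by rewrite mulr_sumr. Qed.

Lemma wsum_add B n g h :
  wsum B n (fun X => g X + h X) = wsum B n g + wsum B n h.
Proof. by rewrite /wsum big_split. Qed.

Lemma wsum_sum B n (I : finType) (g : I -> 'M[R]_D -> R) :
  wsum B n (fun X => \sum_i g i X) = \sum_i wsum B n (g i).
Proof. exact: exchange_big. Qed.

Lemma wsum_exchange B m n (g : 'M[R]_D -> 'M[R]_D -> R) :
  wsum B m (fun X => wsum B n (g X)) =
  wsum B n (fun Y => wsum B m (g^~ Y)).
Proof. exact: exchange_big. Qed.

Lemma wsum_quasi_submult B g C : 0 < C -> (forall X, 0 <= g X) ->
  (forall X Y, g (X *m Y) <= C * g X * g Y) ->
  quasi_submult (fun n => wsum B n g) C.
Proof.
move=> C0 g0 gM; split=> // [n|m n]; first exact: wsum_ge0.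
have -> : C * wsum B m g * wsum B n g =
    wsum B m (fun X => C * wsum B n g * g X) by rewrite wsumZ mulrAC.
rewrite wsumD; apply: wsum_le => X; rewrite mulrAC -wsumZ.
exact: wsum_le.
Qed.

End WordSums.

(** The empty word is excluded because [T] need not preserve the identity. *)
Lemma wsum_morph (R : realType) (K : finType) d D (A : K -> 'M[R]_d)
    (T : 'M[R]_d -> 'M[R]_D) n g : (0 < n)%N ->
  (forall X Y, T (X *m Y) = T X *m T Y) ->
  wsum (T \o A) n g = wsum A n (g \o T).
Proof.
move=> + TM; elim: n g => // -[|n] IH g _.
  by rewrite !wsum1.
rewrite !(wsumS _ n.+1); apply: eq_bigr => i _; rewrite IH//.
by apply: eq_bigr => w _ /=; rewrite TM.
Qed.

(** * Bases adapted to a quasi-norm *)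

Section AdaptedBasis.
Variables (R : realType) (D : nat) (p kappa : R).
Hypotheses (p0 : 0 < p) (kappa1 : 1 <= kappa).

(** The bound below by [l1 v `^ p] keeps the infimum of [F] over unit vectors
    positive. *)
Definition quasinorm (F : 'cV[R]_D -> R) :=
  [/\ forall v, l1 v `^ p <= F v,
      forall c v, F (c *: v) = `|c| `^ p * F v
    & forall u v, F (u + v) <= kappa * (F u + F v)].

Definition supported (S : {set 'I_D}) (v : 'cV[R]_D) :=
  forall i, i \notin S -> v i 0 = 0.

(** The factor 2 dispenses with the compactness of the unit sphere. *)
Lemma almost_minimizer (S : {set 'I_D}) (F : 'cV[R]_D -> R) :
  quasinorm F -> S != finset.set0 ->
  exists v, [/\ supported S v, l1 v = 1 &
    forall y, supported S y -> F v * l1 y `^ p <= 2 * F y].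
Proof.
move=> [Fl1 FZ FD] /set0Pn[i iS].
pose E := [set F v | v in [set v | supported S v /\ l1 v = 1]].
have E1 x : E x -> 1 <= x.
  by move=> [v [_ v1] <-]; rewrite (le_trans _ (Fl1 v))// v1 powR1.
have Ei : E (F (delta_mx i 0)).
  exists (delta_mx i 0) => //; split=> [j jS|].
    by rewrite mxE eqxx andbT; case: eqP jS => // ->; rewrite iS.
  rewrite l1_col (bigD1 i)//= big1 ?addr0 ?mxE ?eqxx ?normr1//.
  by move=> j ji; rewrite mxE (negbTE ji) normr0.
have infE : 1 <= inf E by apply: lb_le_inf => //; exists (F (delta_mx i 0)).
have lbE : has_lbound E by exists 1.
have [|x [v [Sv v1] <-] Fv] := @inf_adherent _ E (inf E) (lt_le_trans ltr01 infE).
  by split=> //; exists (F (delta_mx i 0)).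
exists v; split=> // y Sy.
have [/eqP y0|y0] := eqVneq (l1 y) 0.
  have F0 : 0 <= F y by rewrite (le_trans _ (Fl1 _))// powR_ge0.
  by rewrite (eqP y0) powR0 ?gt_eqF// mulr0 mulr_ge0.
have yp : 0 < l1 y by rewrite lt_neqAle eq_sym y0 l1_ge0.
have infy : inf E <= F ((l1 y)^-1 *: y).
  apply: ge_inf => //; exists ((l1 y)^-1 *: y) => //; split.
    by move=> j jS; rewrite mxE Sy ?mulr0.
  by rewrite l1Z gtr0_norm ?invr_gt0// mulVf.
have -> : F y = l1 y `^ p * F ((l1 y)^-1 *: y).
  rewrite FZ gtr0_norm ?invr_gt0// mulrA -powRM ?invr_ge0 ?ltW//.
  by rewrite mulfV// powR1 mul1r.
rewrite mulrCA mulrC ler_wpM2l ?powR_ge0// (le_trans (ltW Fv))//.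
by rewrite mulr2n mulrDl mul1r lerD.
Qed.

(** A substitute for the John ellipsoid. Each column of [Q] almost minimises [F]
    among the vectors vanishing at the pivots of the previous columns, where the
    pivot of a column is its largest entry. Eliminating the pivot coordinate of
    [x] costs a bounded factor in [F], and the eliminated multiple of the column
    is controlled by [F x] because the column almost minimises [F]. *)
Lemma adapted_frame n : exists2 M, 0 < M &
  forall (S : {set 'I_D}) F, #|S| = n -> quasinorm F ->
  exists (Q : 'M[R]_(D, n)) (P : 'M[R]_(n, D)),
  [/\ forall x, supported S x -> Q *m (P *m x) = x,
      forall j, supported S (col j Q) /\ l1 (col j Q) = 1,
      l1 P <= M,
      forall j x, supported S x ->
        F (col j Q) * `|(P *m x) j 0| `^ p <= M * F x
    & forall i j : 'I_n, (i <= j)%N -> F (col i Q) <= 2 * F (col j Q)].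
Proof.
elim: n => [|n [M M0 IH]].
  exists 1 => // S F /eqP; rewrite cards_eq0 => /eqP -> FQ.
  exists 0, 0; split=> [x Sx|[]//||[]//|[]//].
  - by apply/colP => i; rewrite mul0mx Sx ?finset.inE// mxE.
  - by rewrite l1_0.
pose d := D%:R : R; have d0 : 0 <= d by [].
have dp0 : 0 <= d `^ p by exact: powR_ge0.
pose M1 := d + M * (2 * d); pose M2 := 2 * d `^ p.
pose M3 := M * (kappa * (1 + M2)).
have k0 : 0 < kappa by exact: lt_le_trans kappa1.
have M20 : 0 <= M2 by rewrite mulr_ge0.
have M10 : 0 <= M1 by apply: addr_ge0 => //; apply: mulr_ge0; [exact: ltW|exact: mulr_ge0].
have M30 : 0 < M3 by rewrite !mulr_gt0// ltr_wpDr.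
exists (M1 + M2 + M3); first by apply: ltr_wpDl => //; apply: addr_ge0.
move=> S F cardS FQ; have [Fl1 FZ FD] := FQ.
have F0 x : 0 <= F x by rewrite (le_trans _ (Fl1 _))// powR_ge0.
have S0 : S != finset.set0 by rewrite -card_gt0 cardS.
have [v [Sv v1 vmin]] := almost_minimizer FQ S0.
have [i0 _] := set0Pn _ S0.
pose i := [arg max_(i > i0) `|v i 0|]%O.
have vi : 1 <= d * `|v i 0|.
  rewrite -v1 l1_col mulr_natl -[X in _ *+ X](card_ord D) -sumr_const.
  apply: ler_sum => j _; rewrite /i.
  by case: arg_maxP => // k _; apply.
have vi0 : 0 < `|v i 0|.
  rewrite normr_gt0; apply/eqP => h; move: vi.
  by rewrite h normr0 mulr0 ler10.
have iS : i \in S.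
  by apply/negPn/negP => /Sv h; move: vi0; rewrite h normr0 ltxx.
have vid : `|v i 0|^-1 <= d by rewrite -[leLHS]mul1r ler_pdivrMr.
pose e : 'rV[R]_D := (v i 0)^-1 *: delta_mx 0 i.
have eE (x : 'cV[R]_D) : e *m x = (x i 0 / v i 0)%:M :> 'M[R]_1.
  rewrite -scalemxAl -rowE; apply/matrixP => a b; rewrite !ord1 !mxE mulrC.
  by rewrite mulr1n.
have l1e : l1 e <= d.
  rewrite l1Z normfV (_ : l1 _ = 1) ?mulr1// /l1 big_ord1 (bigD1 i)//=.
  rewrite big1 ?addr0 ?mxE ?eqxx ?normr1// => j ji.
  by rewrite mxE eq_sym (negbTE ji) andbF normr0.
pose Rm : 'M[R]_D := 1%:M - v *m e.
have RmE (x : 'cV[R]_D) : Rm *m x = x - (x i 0 / v i 0) *: v.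
  by rewrite mulmxBl mul1mx -mulmxA eE mul_mx_scalar.
have l1Rm : l1 Rm <= 2 * d.
  rewrite (le_trans (l1D _ _))// -scaleN1r l1Z normrN1 mul1r mulr2n mulrDl mul1r.
  rewrite lerD//; last by rewrite (le_trans (l1_mul _ _))// v1 mul1r.
  rewrite /l1 (eq_bigr (fun=> 1)) => [|a _].
    by rewrite sumr_const card_ord.
  rewrite (bigD1 a)//= big1 ?addr0 ?mxE ?eqxx ?normr1// => b ba.
  by rewrite mxE eq_sym (negbTE ba) normr0.
have xi (x : 'cV[R]_D) : `|x i 0 / v i 0| <= d * l1 x.
  by rewrite normrM normfV mulrC ler_pM// ?invr_ge0// l1_entry.
have Fvx (x : 'cV[R]_D) : supported S x -> F v * `|x i 0 / v i 0| `^ p <= M2 * F x.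
  move=> Sx; rewrite (@le_trans _ _ (F v * (d * l1 x) `^ p))//.
    by rewrite ler_wpM2l// le_powR.
  rewrite powRM ?l1_ge0// mulrCA /M2 (mulrC 2) -mulrA ler_wpM2l//.
  exact: vmin.
have FRm (x : 'cV[R]_D) : supported S x -> F (Rm *m x) <= kappa * (1 + M2) * F x.
  move=> Sx; rewrite RmE -scaleNr (le_trans (FD _ _))// -mulrA ler_pM2l//.
  by rewrite FZ normrN mulrDl mul1r lerD2l mulrC Fvx.
have SRm (x : 'cV[R]_D) : supported S x -> supported (S :\ i) (Rm *m x).
  move=> Sx j; rewrite !inE negb_and negbK RmE !mxE => /predU1P[->|jS].
    by rewrite divfK ?subrr// -normr_gt0.
  by rewrite (Sx j jS) (Sv j jS) mulr0 subr0.
have cardS' : #|S :\ i| = n by move: cardS; rewrite (cardsD1 i) iS => -[].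
have [Q [P [QP SQ lP FP Fmon]]] := IH _ _ cardS' FQ.
have colL k : col (lshift n k) (row_mx v Q) = v.
  by apply/colP => a; rewrite mxE row_mxEl ord1.
have colR k : col (rshift 1 k) (row_mx v Q) = col k Q.
  by apply/colP => a; rewrite [LHS]mxE row_mxEr [RHS]mxE.
have SQ' k : supported S (col k Q).
  move=> a aS; apply: (SQ k).1; rewrite !inE negb_and aS orbT//.
exists (row_mx v Q), (col_mx e (P *m Rm)); split.
- move=> x Sx; rewrite (@mul_col_mx _ 1 n) (@mul_row_col _ _ 1 n) eE -mulmxA QP; last exact: SRm.
  by rewrite mul_mx_scalar RmE subrKC.
- move=> j; have [k ->|k ->] := split_ordP (j : 'I_(1 + n)).
    by rewrite colL.
  by rewrite colR; split; [exact: SQ'|exact: (SQ k).2].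
- have h : l1 e + l1 (P *m Rm) <= M1.
    by rewrite lerD// (le_trans (l1_mul _ _))// ler_pM ?l1_ge0.
  rewrite (@l1_col_mx _ 1 n) (le_trans h)// -addrA lerDl.
  by rewrite addr_ge0// ltW.
- move=> j x Sx; have Fx := F0 x; rewrite (@mul_col_mx _ 1 n).
  have [k ->|k ->] := split_ordP (j : 'I_(1 + n)).
    rewrite colL (@col_mxEu _ 1 n) eE mxE ord1 eqxx mulr1n (le_trans (Fvx _ Sx))//.
    by rewrite ler_wpM2r// addrAC lerDr addr_ge0// ltW.
  rewrite colR (@col_mxEd _ 1 n) -mulmxA (le_trans (FP _ _ (SRm _ Sx)))//.
  rewrite (@le_trans _ _ (M3 * F x))//.
    by rewrite /M3 -mulrA ler_pM2l// FRm.
  by rewrite ler_wpM2r// lerDr addr_ge0.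
- move=> a b; have [k ->|k ->] := split_ordP (a : 'I_(1 + n));
    have [k' ->|k' ->] := split_ordP (b : 'I_(1 + n)); rewrite ?colL ?colR.
  + by move=> _; rewrite mulr2n mulrDl mul1r lerDl.
  + move=> _; have := vmin _ (SQ' k'); rewrite (SQ k').2 powR1 mulr1; exact.
  + by rewrite /= leqNgt ord1.
  + by rewrite /= leq_add2l; exact: Fmon.
Qed.

End AdaptedBasis.

(** * Bochi's inequality for sums over words *)

Section BlockBound.
Variables (R : realType) (D : nat) (p : R).
Hypothesis p0 : 0 < p.

Let phi (X : 'M[R]_D) := l1 X `^ p.

Lemma phi_submult (K : finType) (B : K -> 'M[R]_D) :
  quasi_submult (fun n => wsum B n phi) 1.
Proof.
apply: wsum_quasi_submult => [//|X|X Y]; first exact: powR_ge0.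
by rewrite mul1r -powRM ?l1_ge0// le_powR ?l1_ge0 ?l1_mul.
Qed.

Lemma growth_tail (Z : nat -> R) (C r0 r : R) : 0 < C -> 0 < r0 -> exp_bounded Z r0 ->
  growth Z < r -> exists L, forall n, (L <= n)%N -> C * Z n <= r ^+ n.
Proof.
move=> C0 r00 Zr0 Zr.
pose r1 := (growth Z + r) / 2.
have Zr1 : growth Z < r1 by rewrite midf_lt.
have r1r : r1 < r by rewrite midf_lt.
have r10 : 0 < r1 by rewrite (le_lt_trans (growth_ge0 Z)).
have rp : 0 < r by exact: lt_trans r1r.
have [C1 C10 ZC] := growth_lt r00 Zr0 Zr1.
have q1 : `|r1 / r| < 1.
  have q0 : 0 <= r1 / r by rewrite divr_ge0 ?ltW.
  by rewrite (ger0_norm q0) ltr_pdivrMr ?mul1r.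
have [L _ HL] : \forall n \near \oo, (r1 / r) ^+ n <= (C * C1)^-1.
  have /cvgrPdist_le h := cvg_expr q1.
  have : 0 < (C * C1)^-1 by rewrite invr_gt0 mulr_gt0.
  move=> /h; apply: filterS => n /=; rewrite sub0r normrN ger0_norm//.
  by rewrite exprn_ge0// divr_ge0// ltW.
exists L => n /HL /=; rewrite expr_div_n ler_pdivrMr ?exprn_gt0//.
rewrite ler_pdivlMl ?mulr_gt0// => h; apply: le_trans h.
by rewrite -mulrA ler_pM2l// ZC.
Qed.

Section Frame.
Variables (K : finType) (B : K -> 'M[R]_D) (N : nat) (r : R).
Hypotheses (r0 : 0 < r) (growth_r : growth (fun n => wsum B n phi) < r).

(** The full series over all words, which converges for [r] above the growth
    rate, is multiplied by at most [r] when summed over the images of [v] under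
    the generators; its truncations avoid dealing with convergence. *)
Definition extremal_norm L (v : 'cV[R]_D) :=
  \sum_(n < L.+1) r^-1 ^+ n * wsum B n (fun X => l1 (X *m v) `^ p).

Lemma extremal_quasinorm L : quasinorm p (2 `^ p) (extremal_norm L).
Proof.
have wge0 n v : 0 <= wsum B n (fun X => l1 (X *m v) `^ p).
  by apply: wsum_ge0 => X; exact: powR_ge0.
have r'0 n : 0 <= r^-1 ^+ n by rewrite exprn_ge0// invr_ge0 ltW.
split=> [v|c v|u v].
- rewrite /extremal_norm big_ord_recl expr0 mul1r wsum0 mul1mx lerDl sumr_ge0// => n _.
  by rewrite mulr_ge0.
- rewrite /extremal_norm mulr_sumr; apply: eq_bigr => n _; rewrite mulrCA.
  congr (_ * _); rewrite -wsumZ; apply: eq_bigr => w _.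
  by rewrite -scalemxAr l1Z powRM ?l1_ge0.
- rewrite /extremal_norm -big_split mulr_sumr; apply: ler_sum => n _ /=.
  rewrite -mulrDr mulrCA ler_wpM2l//.
  rewrite -wsum_add -wsumZ; apply: wsum_le => X.
  rewrite mulmxDr (@le_trans _ _ ((l1 (X *m u) + l1 (X *m v)) `^ p))//.
    by rewrite le_powR ?l1_ge0 ?l1D.
  by rewrite powRD_le ?l1_ge0.
Qed.

(** Summing over the words [U] of length [N] shifts the series by [N] places and
    multiplies it by [r ^+ N]. The [N] terms beyond the truncation that enter in
    this way add up to at most [l1 v `^ p], hence the factor 2. *)
Lemma extremal_contraction : exists L, forall v,
  wsum B N (fun U => extremal_norm L (U *m v)) <= 2 * r ^+ N * extremal_norm L v.
Proof.
have [s s0 Bs] := quasi_submult_exp_bounded (phi_submult B).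
have [L HL] := growth_tail (ltr_wpDl (ler0n R N) ltr01) s0 Bs growth_r.
exists L => v; have [Fl1 _ _] := extremal_quasinorm L.
pose W n := wsum B n (fun X => l1 (X *m v) `^ p).
have r'0 n : 0 <= r^-1 ^+ n by rewrite exprn_ge0// invr_ge0 ltW.
have W0 n : 0 <= W n by apply: wsum_ge0 => X; exact: powR_ge0.
have -> : wsum B N (fun U => extremal_norm L (U *m v)) =
    r ^+ N * \sum_(n < L.+1) r^-1 ^+ (n + N) * W (n + N)%N.
  rewrite {1}/extremal_norm wsum_sum mulr_sumr; apply: eq_bigr => n _.
  rewrite wsumZ exprD.
  have rr : r ^+ N * r^-1 ^+ N = 1 by rewrite -exprMn divff ?gt_eqF// expr1n.
  have -> a b w : r ^+ N * (a * b * w) = (r ^+ N * b) * (a * w) :> R by ring.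
  rewrite rr mul1r; congr (_ * _).
  rewrite /W wsumD wsum_exchange; apply: eq_bigr => w _.
  by apply: eq_bigr => w' _; rewrite mulmxA.
rewrite [2 * _]mulrC -mulrA ler_pM2l ?exprn_gt0//.
rewrite (@le_trans _ _ (\sum_(m < L.+1 + N) r^-1 ^+ m * W m))//.
  rewrite addnC big_split_ord/= addrC -[leLHS]addr0 lerD//.
    by apply: ler_sum => i _; rewrite addnC.
  by apply: sumr_ge0 => i _; rewrite mulr_ge0.
rewrite big_split_ord/= -/(extremal_norm L v) mulr2n mulrDl mul1r lerD2l.
apply: le_trans (Fl1 v); rewrite (@le_trans _ _ (\sum_(i < N) (N%:R + 1)^-1 * l1 v `^ p))//.
  apply: ler_sum => i _.
  rewrite (@le_trans _ _ (r^-1 ^+ (L.+1 + i) *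
      (wsum B (L.+1 + i)%N phi * l1 v `^ p)))//.
    rewrite ler_wpM2l// mulrC -wsumZ; apply: wsum_le => X.
    by rewrite mulrC -powRM ?l1_ge0// le_powR ?l1_ge0 ?l1_mul.
  rewrite mulrA ler_wpM2r ?powR_ge0// exprVn ler_pdivrMl ?exprn_gt0//.
  rewrite ler_pdivlMr; last by rewrite ltr_wpDl.
  by rewrite mulrC HL// addSnnS leq_addr.
rewrite sumr_const card_ord -[leLHS]mulr_natl mulrA ler_piMl ?powR_ge0//.
by rewrite ler_pdivrMr ?ltr_wpDl// mul1r lerDl.
Qed.

End Frame.

(** In a basis adapted to the extremal norm, [block_bound] bounds the sums over
    words of the entries on and below the diagonal by [r ^+ N], while the other
    entries are only bounded by the sum of the norms. An entry of a product of
    [D.+1] blocks is a sum over paths of [D.+1] steps through [D] indices; such a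
    path cannot go up at each step, so it uses one of the small entries. *)
Lemma block_bound : exists2 C, 0 < C &
  forall (K : finType) (B : K -> 'M[R]_D) N r, 0 < r ->
  growth (fun n => wsum B n phi) < r ->
  wsum B (D.+1 * N) phi <= C * r ^+ N * wsum B N phi ^+ D.
Proof.
have k1 : 1 <= 2 `^ p :> R by rewrite -[leLHS](powRr0 2); apply: ler_powR; rewrite ?ler1n// ltW.
have [M M0 HM] := adapted_frame D p0 k1 D.
have Mge0 : 0 <= M by exact: ltW.
pose d := D%:R : R; have d0 : 0 <= d by [].
pose c := d `^ p * (d * 2).
have c0 : 0 <= c by rewrite !mulr_ge0 ?powR_ge0.
pose C := (d * M) `^ p * ((d * d) `^ p * (d * d)) * c ^+ D * (4 * M) * ((M * d) `^ p) ^+ D.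
have C0 : 0 <= C.
  by rewrite !mulr_ge0 ?exprn_ge0 ?powR_ge0// ltW.
exists (C + 1) => [|K B N r r0 gr]; first by rewrite ltr_wpDl.
have [L FL] := extremal_contraction N r0 gr.
have FQ := extremal_quasinorm B r0 L.
move: FL FQ; set F := extremal_norm B r L => FL FQ.
have [Q [P [QP SQ lP FP Fmon]]] := HM [set: 'I_D]%SET F (etrans (cardsT _) (card_ord D)) FQ.
have sT (x : 'cV[R]_D) : supported [set: 'I_D]%SET x by move=> i; rewrite finset.inE.
have F1 i : 0 < F (col i Q).
  have [Fl1 _ _] := FQ; rewrite (lt_le_trans _ (Fl1 _))//.
  by rewrite (SQ i).2 powR1.
have QP1 : Q *m P = 1%:M.
  apply/matrixP => i j; have := QP (delta_mx j 0) (sT _).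
  rewrite mulmxA -colE => /colP/(_ i); rewrite [LHS]mxE => ->.
  by rewrite !mxE andbT.
have lQ : l1 Q = d.
  rewrite /l1 exchange_big/= -[d](_ : \sum_(j < D) 1 = _).
    by apply: eq_bigr => j _; rewrite -(SQ j).2 l1_col; apply: eq_bigr => i _; rewrite mxE.
  by rewrite sumr_const card_ord.
pose b X i j : R := `|(P *m X *m Q) i j| `^ p.
have b0 X i j : 0 <= b X i j by exact: powR_ge0.
pose e := 4 * M * r ^+ N; pose Y := (M * d) `^ p * wsum B N phi.
have e0 : 0 <= e by rewrite !mulr_ge0 ?exprn_ge0// ltW.
have Y0 : 0 <= Y.
  by rewrite mulr_ge0 ?powR_ge0// wsum_ge0// => X; exact: powR_ge0.
have aY (i j : 'I_D) : wsum B N (fun U => b U i j) <= Y.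
  rewrite /Y -wsumZ; apply: wsum_le => X.
  rewrite /phi -powRM ?l1_ge0 ?mulr_ge0// le_powR//.
  rewrite (le_trans (l1_entry _ _ _))// (le_trans (l1_mul _ _))// lQ mulrAC.
  by rewrite ler_wpM2r// (le_trans (l1_mul _ _))// ler_wpM2r ?l1_ge0.
have ae (i j : 'I_D) : (j <= i)%N -> wsum B N (fun U => b U i j) <= e.
  move=> ji; rewrite -(ler_pM2l (F1 i)) -wsumZ.
  rewrite (@le_trans _ _ (M * wsum B N (fun U => F (U *m col j Q))))//.
    rewrite -wsumZ; apply: wsum_le => U; rewrite /b.
    have := FP i _ (sT (U *m col j Q)); congr (_ * `|_| `^ _ <= _).
    by rewrite (colE j Q) !mulmxA -colE mxE.
  rewrite (@le_trans _ _ (M * (2 * r ^+ N * (2 * F (col i Q)))))//.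
    rewrite ler_pM2l// (le_trans (FL _))// ler_pM2l ?Fmon//.
    by rewrite mulr_gt0// exprn_gt0.
  by rewrite /e le_eqVlt; apply/orP; left; apply/eqP; ring.
(* The last block is split off a word of [n.+1] blocks. *)
have step n (i j : 'I_D) : wsum B (n.+1 * N) (fun X => b X i j) <=
    d `^ p * \sum_k wsum B (n * N) (fun X => b X i k) * wsum B N (fun U => b U k j).
  have bXY X U : b (X *m U) i j <= d `^ p * \sum_k b X i k * b U k j.
    rewrite /b; have -> : P *m (X *m U) *m Q = (P *m X *m Q) *m (P *m U *m Q).
      by rewrite !mulmxA -[_ *m Q *m P]mulmxA QP1 mulmx1.
    rewrite mxE.
    rewrite (@le_trans _ _ ((\sum_k `|(P *m X *m Q) i k * (P *m U *m Q) k j|) `^ p))//.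
      by rewrite le_powR// ler_norm_sum.
    rewrite (le_trans (powR_sum_le _ _))// ?card_ord// ler_wpM2l ?powR_ge0//.
    by apply: ler_sum => k _; rewrite normrM powRM.
  rewrite mulSn addnC wsumD.
  rewrite (@le_trans _ _ (wsum B (n * N) (fun X => wsum B N (fun U =>
     d `^ p * \sum_k b X i k * b U k j))))//.
    by apply: wsum_le => X; apply: wsum_le => U.
  rewrite le_eqVlt; apply/orP; left; apply/eqP.
  under eq_fun do rewrite wsumZ wsum_sum.
  rewrite wsumZ wsum_sum; congr (_ * _); apply: eq_bigr => k _.
  by under eq_fun do rewrite wsumZ mulrC; rewrite wsumZ mulrC.
(* The second term accounts for the paths going up at each of the [n.+1] steps. *)
have path n (i j : 'I_D) : wsum B (n.+1 * N) (fun X => b X i j) <=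
    c ^+ n * (e * Y ^+ n + (i + n < j)%N%:R * Y ^+ n.+1).
  elim: n i j => [|n IH] i j.
    rewrite mul1n expr0 mul1r mulr1 expr1 addn0.
    by have [ij|ji] := ltnP i j; rewrite ?mul1r ?mul0r ?addr0 ?ae// ler_wpDl.
  rewrite (le_trans (step _ _ _))// exprS; set E := _ + _.
  have -> : c * c ^+ n * E = d `^ p * (d * (c ^+ n * (2 * E))).
    by rewrite {1}/c; ring.
  rewrite ler_wpM2l ?powR_ge0// {}/E.
  rewrite /d -[X in _ <= X%:R * _](card_ord D) mulr_natl -sumr_const.
  apply: ler_sum => k _.
  rewrite (le_trans (ler_wpM2r _ (IH _ _)))//; first exact: wsum_ge0.
  rewrite -mulrA ler_wpM2l ?exprn_ge0// mulrDl.
  have h1 : e * Y ^+ n * wsum B N (fun U => b U k j) <= e * Y ^+ n.+1.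
    by rewrite exprSr mulrA ler_wpM2l// mulr_ge0// exprn_ge0.
  have h2 : (i + n < k)%N%:R * Y ^+ n.+1 * wsum B N (fun U => b U k j) <=
      e * Y ^+ n.+1 + (i + n.+1 < j)%N%:R * Y ^+ n.+2.
    have [ik|ki] := ltnP (i + n) k; last first.
      by rewrite !mul0r addr_ge0// mulr_ge0// exprn_ge0.
    rewrite mul1r; have [kj|jk] := ltnP k j.
      rewrite addnS (leq_ltn_trans ik kj) mul1r [Y ^+ n.+2]exprSr.
      apply: ler_wpDl; first by rewrite mulr_ge0 ?exprn_ge0.
      by rewrite ler_wpM2l// exprn_ge0.
    apply: ler_wpDr; first by rewrite mulr_ge0 ?exprn_ge0.
    rewrite mulrC.
    by rewrite ler_wpM2r ?exprn_ge0// ae.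
  rewrite (le_trans (lerD h1 h2))// mulr2n mulrDl mul1r.
  set x := e * _; set y := (_ < _)%N%:R * _.
  have : 0 <= y by rewrite mulr_ge0// exprn_ge0.
  by move=> y0; rewrite lerD// lerDl.
rewrite (@le_trans _ _ (C * r ^+ N * wsum B N phi ^+ D))//; last first.
  rewrite ler_wpM2r ?ler_wpM2r ?lerDl// exprn_ge0//; last exact: ltW.
  by apply: wsum_ge0 => X; exact: powR_ge0.
rewrite (@le_trans _ _ (wsum B (D.+1 * N)
    (fun X => (d * M) `^ p * ((d * d) `^ p * \sum_(q : 'I_D * 'I_D) b X q.1 q.2))))//.
  apply: wsum_le => X; rewrite (@le_trans _ _ ((d * M * l1 (P *m X *m Q)) `^ p))//.
    rewrite le_powR ?l1_ge0//.
    have {1}-> : X = Q *m (P *m X *m Q) *m P.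
      by rewrite !mulmxA QP1 mul1mx -mulmxA QP1 mulmx1.
    rewrite (le_trans (l1_mul _ _))// mulrAC ler_pM ?l1_ge0//.
    by rewrite (le_trans (l1_mul _ _))// lQ.
  rewrite powRM ?l1_ge0 ?mulr_ge0// ler_wpM2l ?powR_ge0//.
  have := @powR_sum_le R ('I_D * 'I_D)%type p (fun q => `|(P *m X *m Q) q.1 q.2|) p0.
  rewrite card_prod card_ord natrM => h.
  by rewrite /l1 pair_big; apply: h.
rewrite !wsumZ wsum_sum.
have -> : C * r ^+ N * wsum B N phi ^+ D =
  (d * M) `^ p * ((d * d) `^ p * (d * d * (c ^+ D * (e * Y ^+ D)))).
  rewrite /C /e (_ : Y ^+ D = ((M * d) `^ p) ^+ D * wsum B N phi ^+ D);
    last by rewrite exprMn.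
  move: (c ^+ D) (wsum B N phi ^+ D) (r ^+ N) (((M * d) `^ p) ^+ D).
  by move: ((d * M) `^ p) ((d * d) `^ p) => *; ring.
rewrite !ler_wpM2l ?powR_ge0//.
rewrite (le_trans (ler_sum _ (fun q _ => path D q.1 q.2)))//.
rewrite (eq_bigr (fun=> c ^+ D * (e * Y ^+ D))) => [|q _].
  by rewrite sumr_const card_prod card_ord -mulr_natl natrM.
by rewrite ltnNge (leq_trans (ltnW (ltn_ord _)) (leq_addl _ _)) mul0r addr0.
Qed.

End BlockBound.

(** * Minors of products *)

Section CauchyBinet.
Variable (R : comNzRingType).

(** Multilinearity of the determinant in the rows of the product. *)
Lemma det_mulmx_rowsub m d (X : 'M[R]_(m, d)) (Y : 'M[R]_(d, m)) :
  \det (X *m Y) =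
  \sum_(h : {ffun 'I_m -> 'I_d}) (\prod_i X i (h i)) * \det (rowsub h Y).
Proof.
rewrite /determinant.
transitivity (\sum_(s : 'S_m) \sum_(h : {ffun 'I_m -> 'I_d})
    (-1) ^+ s * \prod_i (X i (h i) * Y (h i) (s i))).
  apply: eq_bigr => s _; rewrite -mulr_sumr; congr (_ * _).
  rewrite -(bigA_distr_bigA (fun i k => X i k * Y k (s i))).
  by apply: eq_bigr => i _; rewrite mxE.
rewrite exchange_big; apply: eq_bigr => h _; rewrite mulr_sumr.
apply: eq_bigr => s _; rewrite big_split/= mulrCA; congr (_ * (_ * _)).
by apply: eq_bigr => i _; rewrite mxE.
Qed.

Lemma det_rowsub_perm m d (h : 'I_m -> 'I_d) (s : 'S_m) (Y : 'M[R]_(d, m)) :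
  \det (rowsub (h \o s) Y) = (-1) ^+ s * \det (rowsub h Y).
Proof.
have -> : rowsub (h \o s) Y = row_perm s (rowsub h Y).
  by apply/matrixP => i j; rewrite !mxE.
by rewrite row_permE det_mulmx det_perm.
Qed.

(** Summing over all maps [h], instead of the increasing ones, counts each minor
    [m`!] times and makes the antisymmetrisation of [det_mulmx_rowsub] a plain
    reindexing. *)
Lemma cauchy_binet m d (X : 'M[R]_(m, d)) (Y : 'M[R]_(d, m)) :
  (m`!)%:R * \det (X *m Y) =
  \sum_(h : {ffun 'I_m -> 'I_d}) \det (colsub h X) * \det (rowsub h Y).
Proof.
transitivity (\sum_(s : 'S_m) \det (X *m Y)).
  by rewrite sumr_const card_Sn mulr_natl.
pose hp (s : 'S_m) (h : {ffun 'I_m -> 'I_d}) : {ffun 'I_m -> 'I_d} :=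
  [ffun i => h (s i)].
have hpK s : cancel (hp s) (hp (s^-1)%g).
  by move=> h; apply/ffunP => i; rewrite !ffunE permKV.
transitivity (\sum_(h : {ffun 'I_m -> 'I_d}) \sum_(s : 'S_m)
    (-1) ^+ s * (\prod_i X i (hp s h i)) * \det (rowsub h Y)); last first.
  apply: eq_bigr => h _; rewrite /determinant mulr_suml; apply: eq_bigr => s _.
  congr (_ * _ * _); apply: eq_bigr => i _.
  by rewrite mxE ffunE.
rewrite [RHS]exchange_big; apply: eq_bigr => s _ /=.
rewrite det_mulmx_rowsub (reindex_inj (can_inj (hpK s))).
apply: eq_bigr => h _; rewrite [in RHS]mulrAC [in RHS]mulrC; congr (_ * _).
rewrite -det_rowsub_perm; congr (\det _).
by apply/matrixP => i j; rewrite !mxE ffunE.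
Qed.

Lemma cauchy_binet_mxsub m d (f g : 'I_m -> 'I_d) (A B : 'M[R]_d) :
  (m`!)%:R * \det (mxsub f g (A *m B)) =
  \sum_(h : {ffun 'I_m -> 'I_d}) \det (mxsub f h A) * \det (mxsub h g B).
Proof.
have -> : mxsub f g (A *m B) = rowsub f A *m colsub g B.
  apply/matrixP => i j; rewrite !mxE; apply: eq_bigr => k _.
  by rewrite !mxE.
rewrite cauchy_binet; apply: eq_bigr => h _.
by congr (_ * _); congr (\det _); apply/matrixP => i j; rewrite !mxE.
Qed.

(** The sum of the principal minors is, up to a factor, the trace of the compound
    matrix, hence invariant under cyclic permutations. The factor [m`!] is kept
    because it may be a zero divisor in [R]. *)
Lemma principal_minors_mulC m d (A B : 'M[R]_d) :
  (m`!)%:R * \sum_(f : {ffun 'I_m -> 'I_d}) \det (mxsub f f (A *m B)) =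
  (m`!)%:R * \sum_(f : {ffun 'I_m -> 'I_d}) \det (mxsub f f (B *m A)).
Proof.
rewrite !mulr_sumr.
under eq_bigr do rewrite cauchy_binet_mxsub.
under [RHS]eq_bigr do rewrite cauchy_binet_mxsub.
rewrite exchange_big; apply: eq_bigr => f _; apply: eq_bigr => g _.
by rewrite mulrC.
Qed.

End CauchyBinet.

(** * Continuity in the entries and representation norms *)

Section EntryContinuity.
Variables (R : realType) (d : nat).
Implicit Types (g h : 'M[R]_d -> R).

(** Arbitrary filters serve both the neighbourhoods of a tuple of matrices and
    those of a pair of a tuple and an exponent. *)
Definition entry_cvg (T : Type) (F : set_system T) (f : T -> 'M[R]_d)
    (A : 'M[R]_d) :=
  forall i j, f u i j @[u --> F] --> A i j.

Definition entry_continuous g :=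
  forall (T : Type) (F : set_system T) (f : T -> 'M[R]_d) A, Filter F ->
    entry_cvg F f A -> g (f u) @[u --> F] --> g A.

Lemma cvg_bigsum (T I : Type) (F : set_system T) (r : seq I) (P : pred I)
    (f : I -> T -> R) (l : I -> R) : Filter F ->
  (forall i, P i -> f i x @[x --> F] --> l i) ->
  \sum_(i <- r | P i) f i x @[x --> F] --> \sum_(i <- r | P i) l i.
Proof.
move=> FF fl; apply: cvg_big => //.
by move=> x; apply: cvgD; [exact: cvg_fst|exact: cvg_snd].
Qed.

Lemma cvg_bigprod (T I : Type) (F : set_system T) (r : seq I) (P : pred I)
    (f : I -> T -> R) (l : I -> R) : Filter F ->
  (forall i, P i -> f i x @[x --> F] --> l i) ->
  \prod_(i <- r | P i) f i x @[x --> F] --> \prod_(i <- r | P i) l i.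
Proof.
move=> FF fl; apply: cvg_big => //.
exact: mul_continuous.
Qed.

Lemma entry_continuous_det : entry_continuous (fun A => \det A).
Proof.
move=> T F f A FF fA; apply: cvg_bigsum => // s _; apply: cvgM; first exact: cvg_cst.
by apply: cvg_bigprod => i _; exact: fA.
Qed.

Lemma entry_cvg_mul (T : Type) (F : set_system T) (f g : T -> 'M[R]_d) A B :
  Filter F -> entry_cvg F f A -> entry_cvg F g B ->
  entry_cvg F (fun u => f u *m g u) (A *m B).
Proof.
move=> FF fA gB i j; rewrite mxE; under eq_fun do rewrite mxE.
by apply: cvg_bigsum => k _; apply: cvgM; [exact: fA|exact: gB].
Qed.

Lemma wsum_cvg (K : finType) (T : Type) (F : set_system T) (B : T -> K -> 'M[R]_d)
    (B0 : K -> 'M[R]_d) n g : Filter F -> entry_continuous g ->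
  (forall i, entry_cvg F (B^~ i) (B0 i)) ->
  wsum (B u) n g @[u --> F] --> wsum B0 n g.
Proof.
move=> FF gc BB0; apply: cvg_bigsum => w _; apply: gc.
elim: (tval w) => [|i s IH].
  by rewrite big_nil; under eq_fun do rewrite big_nil; move=> i j; exact: cvg_cst.
rewrite big_cons; under eq_fun do rewrite big_cons.
exact: entry_cvg_mul.
Qed.

End EntryContinuity.

Lemma entry_continuous_minor (R : realType) m d (f g : 'I_m -> 'I_d) :
  entry_continuous (fun A : 'M[R]_d => \det (mxsub f g A)).
Proof.
move=> T F h A FF hA; apply: entry_continuous_det => i j.
by rewrite mxE; under eq_fun do rewrite mxE; exact: hA.
Qed.

Section RepNorm.
Variables (R : realType) (d : nat).
Implicit Types (N : 'M[R]_d -> R).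

(** [N A] is the entrywise l1 norm of [t A], for a continuous multiplicative
    family [t A] of matrices indexed by a finite type; [t] need not preserve
    the identity. *)
Definition rep_norm N := exists (I : finType) (t : 'M[R]_d -> I -> I -> R),
  [/\ forall A B x y, t (A *m B) x y = \sum_z t A x z * t B z y,
      forall x y, entry_continuous (fun A => t A x y)
    & forall A, N A = \sum_x \sum_y `|t A x y|].

Lemma rep_norm1 : rep_norm (fun=> 1).
Proof.
exists unit, (fun _ _ _ => 1); split=> [A B x y|x y|A].
- by rewrite (big_pred1 tt) ?mulr1 => // -[].
- by move=> *; exact: cvg_cst.
- by rewrite (big_pred1 tt) ?(big_pred1 tt) ?normr1 => // -[].
Qed.

Lemma rep_norm_det : rep_norm (fun A => `|\det A|).
Proof.
exists unit, (fun A _ _ => \det A); split=> [A B x y|x y|A].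
- by rewrite (big_pred1 tt) ?det_mulmx => // -[].
- exact: entry_continuous_det.
- by rewrite (big_pred1 tt) ?(big_pred1 tt) => // -[].
Qed.

(** The entries of a Kronecker product are products of entries, so its l1 norm
    is the product of the norms. *)
Lemma rep_normM N1 N2 :
  rep_norm N1 -> rep_norm N2 -> rep_norm (fun A => N1 A * N2 A).
Proof.
move=> [I [t [tM tc tN]]] [J [s [sM sc sN]]].
exists (I * J)%type, (fun A x y => t A x.1 y.1 * s A x.2 y.2).
split=> [A B x y|x y|A].
- rewrite tM sM big_distrlr/= pair_big/=.
  by apply: eq_bigr => -[i j] _ /=; rewrite mulrACA.
- by move=> T F f A FF fA; apply: cvgM; [exact: tc|exact: sc].
- rewrite tN sN big_distrlr/= pair_big/=; apply: eq_bigr => -[i j] _ /=.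
  rewrite big_distrlr/= pair_big/=; apply: eq_bigr => -[i' j'] _ /=.
  by rewrite normrM.
Qed.

Lemma rep_normX N n : rep_norm N -> rep_norm (fun A => N A ^+ n).
Proof.
move=> rN; elim: n => [|n IH].
  by under eq_fun do rewrite expr0; exact: rep_norm1.
by under eq_fun do rewrite exprS; exact: rep_normM.
Qed.

Definition minor_norm m (A : 'M[R]_d) : R :=
  \sum_(f : {ffun 'I_m -> 'I_d}) \sum_(g : {ffun 'I_m -> 'I_d})
    `|\det (mxsub f g A) / (m`!)%:R|.

(** The family is the [m]-th compound, with rows and columns repeated; dividing
    by [m`!] makes it multiplicative, by [cauchy_binet_mxsub]. *)
Lemma rep_norm_minor m : rep_norm (minor_norm m).
Proof.
exists {ffun 'I_m -> 'I_d},
  (fun A (f g : {ffun 'I_m -> 'I_d}) => \det (mxsub f g A) / (m`!)%:R).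
have m0 : (m`!)%:R != 0 :> R by rewrite pnatr_eq0 -lt0n fact_gt0.
split=> [A B f g|f g|//].
- apply: (mulfI m0); rewrite mulrA cauchy_binet_mxsub mulr_suml mulr_sumr.
  apply: eq_bigr => h _.
  by move: (\det _) (\det (mxsub h g B)) (m`!)%:R m0 => a b c c0; field.
- move=> T F h A FF hA; apply: cvgM; last exact: cvg_cst.
  exact: entry_continuous_minor.
Qed.

Lemma rep_norm_matrix N : rep_norm N -> exists D (T : 'M[R]_d -> 'M[R]_D),
  [/\ forall A B, T (A *m B) = T A *m T B,
      forall i j, entry_continuous (fun A => T A i j)
    & forall A, l1 (T A) = N A].
Proof.
move=> [I [t [tM tc tN]]].
exists #|I|, (fun A => \matrix_(i, j) t A (enum_val i) (enum_val j)).
split=> [A B|i j|A].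
- apply/matrixP => i j; rewrite !mxE tM.
  rewrite (reindex _ (onW_bij _ (enum_val_bij I))); apply: eq_bigr => k _.
  by rewrite !mxE.
- by under eq_fun do rewrite mxE; exact: tc.
- rewrite tN (reindex _ (onW_bij _ (enum_val_bij I))); apply: eq_bigr => i _.
  rewrite (reindex _ (onW_bij _ (enum_val_bij I))); apply: eq_bigr => j _.
  by rewrite mxE.
Qed.

Lemma rep_norm_ge0 N A : rep_norm N -> 0 <= N A.
Proof. by move=> /rep_norm_matrix[D [T [_ _ <-]]]; exact: l1_ge0. Qed.

Lemma rep_norm_submult N A B : rep_norm N -> N (A *m B) <= N A * N B.
Proof.
by move=> /rep_norm_matrix[D [T [TM _ TN]]]; rewrite -!TN TM l1_mul.
Qed.

Lemma rep_norm_continuous N : rep_norm N -> entry_continuous N.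
Proof.
move=> [I [t [tM tc tN]]] T F f A FF fA; rewrite tN; under eq_fun do rewrite tN.
apply: cvg_bigsum => x _; apply: cvg_bigsum => y _; apply: cvg_norm.
exact: tc.
Qed.

Lemma rep_norm_quasi_submult (K : finType) (A : K -> 'M[R]_d) N p :
  rep_norm N -> 0 < p ->
  quasi_submult (fun n => wsum A n (fun X => N X `^ p)) 1.
Proof.
move=> rN p0; have N0 X := rep_norm_ge0 X rN.
apply: wsum_quasi_submult => [//|X|X Y]; first exact: powR_ge0.
by rewrite mul1r -powRM// le_powR// rep_norm_submult.
Qed.

End RepNorm.

(** * Continuity of the growth rate of a representation norm *)

Section GrowthContinuity.
Variable R : realType.

Lemma eq_growth (Z W : nat -> R) :
  (forall n, (0 < n)%N -> Z n = W n) -> growth Z = growth W.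
Proof.
move=> ZW; suff sub (X Y : nat -> R) r : (forall n, (0 < n)%N -> X n = Y n) ->
    exp_bounded X r -> 0 < r -> exp_bounded Y r.
  by congr inf; apply/seteqP; split=> r [r0 h] /=; split=> //;
    apply: sub h r0 => // n n0; rewrite ZW.
move=> XY [C C0 XC] r0; exists (C + `|Y 0%N|) => [|n]; first by rewrite ltr_wpDr.
case: n => [|n]; first by rewrite expr0 mulr1 ler_wpDl ?ler_norm// ltW.
rewrite -XY// (le_trans (XC _))// ler_wpM2r ?lerDl// exprn_ge0//.
exact: ltW.
Qed.

Lemma cvg_of_bounds (T : Type) (F : set_system T) (f : T -> R) (l : R) : Filter F ->
  (forall b, l < b -> \forall x \near F, f x <= b) ->
  (forall a, a < l -> \forall x \near F, a <= f x) ->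
  f x @[x --> F] --> l.
Proof.
move=> FF up dn; apply/cvgrPdist_le => e e0.
near=> x; rewrite ler_distlC; apply/andP; split; near: x.
  by apply: dn; rewrite ltrBlDr ltrDl.
by apply: up; rewrite ltrDl.
Unshelve. all: by end_near. Qed.

(** Upper semicontinuity: by [growth_fekete] the growth rate is an infimum of
    continuous functions. Lower semicontinuity: if the rate were below [a] near
    [A0], then [block_bound] would bound the sum over the words of length
    [D.+1 * n] by [C * a ^+ n] times the [D]-th power of the sum over the words
    of length [n]. Both sides are continuous for fixed [n], and at [A0] the
    inequality fails for large [n] when [a] is below the growth rate. *)
Lemma growth_cvg d (N : 'M[R]_d -> R) p (K : finType) (T : Type)
    (F : set_system T) (A : T -> K -> 'M[R]_d) (A0 : K -> 'M[R]_d) :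
  Filter F -> rep_norm N -> 0 < p -> (forall i, entry_cvg F (A^~ i) (A0 i)) ->
  growth (fun n => wsum (A u) n (fun X => N X `^ p)) @[u --> F] -->
    growth (fun n => wsum A0 n (fun X => N X `^ p)).
Proof.
move=> FF rN p0 AA0; set g := fun X => N X `^ p.
have gc : entry_continuous g.
  move=> T' F' f a FF' fa; apply: cvg_powR => //.
  - exact: rep_norm_ge0.
  - by move=> x; exact: rep_norm_ge0.
  - exact: rep_norm_continuous.
have qs (B : K -> 'M[R]_d) : quasi_submult (fun n => wsum B n g) 1.
  exact: rep_norm_quasi_submult.
have fek (B : K -> 'M[R]_d) n : (0 < n)%N ->
    growth (fun n => wsum B n g) ^+ n <= wsum B n g.
  by move=> n0; have := growth_fekete (qs B) n0; rewrite mul1r.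
have g0 X : 0 <= g X by exact: powR_ge0.
set rho0 := growth _.
have rho00 : 0 <= rho0 by exact: growth_ge0.
have [s s0 Bs] := quasi_submult_exp_bounded (qs A0).
apply: cvg_of_bounds => [b lb|a la].
  have [L HL] := growth_tail (ltr0Sn R 1) s0 Bs lb.
  have b0 : 0 < b by exact: le_lt_trans lb.
  have lt : wsum A0 L.+1 g < b ^+ L.+1.
    have := HL _ (leqnSn L); rewrite -(ltr_pM2l (ltr0Sn R 1)) => h.
    by rewrite (le_lt_trans h)// ltr_pMl ?exprn_gt0// ltr1n.
  have := wsum_cvg (n := L.+1) FF gc AA0 => /cvgr_lt /(_ _ lt).
  apply: filterS => u /= ub; rewrite leNgt; apply/negP => lt'.
  have := fek (A u) _ (ltn0Sn L); rewrite leNgt (lt_trans ub)//.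
  by rewrite ltrXn2r// ltW.
have [a0|a0] := lerP a 0.
  by apply: nearW => u; exact: le_trans a0 (growth_ge0 _).
have r0p : 0 < rho0 by exact: lt_trans la.
have [D [Tm [TM Tc TN]]] := rep_norm_matrix rN.
have [C C0 HC] := block_bound D p0.
have gE (B : K -> 'M[R]_d) n : (0 < n)%N ->
    wsum (Tm \o B) n (fun X => l1 X `^ p) = wsum B n g.
  move=> n0; rewrite wsum_morph//; apply: eq_bigr => w _.
  by rewrite /g /= TN.
have growthE (B : K -> 'M[R]_d) :
    growth (fun n => wsum (Tm \o B) n (fun X => l1 X `^ p)) =
    growth (fun n => wsum B n g).
  by apply: eq_growth => n; exact: gE.
(* [r] is chosen above [rho0] so that [a * r ^+ D < rho0 ^+ D.+1]. *)
pose r := rho0 * (rho0 / a) `^ (D.+1%:R)^-1.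
have q1 : 1 < (rho0 / a) `^ (D.+1%:R)^-1.
  rewrite -[ltLHS](_ : 1 `^ (D.+1%:R)^-1 = 1); last by rewrite powR1.
  rewrite gt0_ltr_powR ?nnegrE ?invr_gt0//; first by rewrite divr_ge0// ltW.
  by rewrite ltr_pdivlMr// mul1r.
have rr : rho0 < r by rewrite ltr_pMr.
have rp : 0 < r by exact: lt_trans rr.
have rX : a * r ^+ D.+1 = rho0 ^+ D.+2.
  have qK : ((rho0 / a) `^ (D.+1%:R)^-1) ^+ D.+1 = rho0 / a.
    by rewrite powR_rootK// divr_ge0// ltW.
  by rewrite exprMn qK mulrCA [a * _]mulrC divfK ?gt_eqF// -exprSr.
have ar : a * r ^+ D < rho0 ^+ D.+1.
  rewrite -(ltr_pM2r rp) -mulrA -exprSr rX exprSr ltr_pM2l ?exprn_gt0//.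
have [C1 C10 ZC] := growth_lt s0 Bs rr.
have [n n0 Hn] : exists2 n, (0 < n)%N &
    C * C1 ^+ D * (a * r ^+ D) ^+ n < (rho0 ^+ D.+1) ^+ n.
  apply: contrapT => h; move: ar; rewrite ltNge => /negP; apply.
  apply: (@exp_le_base _ _ _ (C * C1 ^+ D)).
  - by rewrite exprn_ge0.
  - by rewrite mulr_gt0// exprn_gt0.
  - move=> n n0; rewrite leNgt; apply/negP => lt.
    by apply: h; exists n.
have key : C * a ^+ n * wsum A0 n g ^+ D < wsum A0 (D.+1 * n) g.
  apply: lt_le_trans (fek A0 _ _); last by rewrite muln_gt0.
  rewrite exprM (le_lt_trans _ Hn)// -mulrA -[leRHS]mulrA ler_pM2l//.
  rewrite exprMn mulrCA ler_pM2l ?exprn_gt0// exprAC -exprMn.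
  have CR0 : 0 <= C1 * r ^+ n by rewrite mulr_ge0 ?exprn_ge0 ?ltW.
  by rewrite lerXn2r ?nnegrE ?ZC// wsum_ge0.
have keyu : \forall u \near F,
    0 < wsum (A u) (D.+1 * n) g - C * a ^+ n * wsum (A u) n g ^+ D.
  have c1 := wsum_cvg (n := (D.+1 * n)%N) FF gc AA0.
  have c2 : C * a ^+ n * wsum (A u) n g ^+ D @[u --> F] -->
      C * a ^+ n * wsum A0 n g ^+ D.
    apply: cvgM; first exact: cvg_cst.
    have c3 := wsum_cvg (n := n) FF gc AA0.
    exact: (cvg_comp _ _ c3 (@exprn_continuous R D _)).
  by apply: (cvgr_gt _ (cvgB c1 c2)); rewrite subr_gt0.
apply: filterS keyu => u; rewrite subr_gt0 => lt; rewrite leNgt; apply/negP.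
rewrite -growthE => ua.
have := HC K (Tm \o A u) n a a0 ua.
by rewrite !gE ?muln_gt0// leNgt lt.
Qed.

End GrowthContinuity.

(** * Singular values and minors *)

Section GramSpectrum.

Lemma char_poly_similar (F : comNzRingType) d (A B P Q : 'M[F]_d) :
  Q *m P = 1%:M -> A = Q *m B *m P -> char_poly A = char_poly B.
Proof.
move=> QP ->; rewrite /char_poly.
have QP' : map_mx polyC Q *m map_mx polyC P = 1%:M.
  by rewrite -map_mxM QP map_mx1.
have -> : char_poly_mx (Q *m B *m P) =
    map_mx polyC Q *m char_poly_mx B *m map_mx polyC P.
  rewrite /char_poly_mx !map_mxM mulmxBr mulmxBl; congr (_ - _).
  by rewrite scalar_mxC -mulmxA QP' mulmx1.
rewrite !det_mulmx mulrAC -det_mulmx QP' det1 mul1r //.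
Qed.

(** The eigenvalues are nonnegative because, in the eigenbasis, the diagonal
    entries of the Gram matrix are squared norms of columns. *)
Lemma spectral_gram (C : numClosedFieldType) d (A : 'M[C]_d)
    (H := (A ^t*)%sesqui *m A) :
  H = invmx (spectralmx H) *m diag_mx (spectral_diag H) *m spectralmx H /\
  forall i, 0 <= spectral_diag H 0 i.
Proof.
have Hherm : H \is hermsymmx.
  by rewrite qualifE/= expr0 scale1r trmx_mul map_mxM trmxCK.
have /orthomx_spectralP := hermitian_normalmx Hherm.
have Punit := spectral_unit H; have Pu := spectral_unitarymx H.
set P := spectralmx H in Pu Punit *; set dl := spectral_diag H => Hsp.
split=> // i; have -> : dl 0 i = (diag_mx dl) i i by rewrite mxE eqxx mulr1n.
have -> : diag_mx dl = P *m H *m invmx P.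
  by rewrite {1}Hsp !mulmxA mulmxV// mul1mx mulmxK.
rewrite invmx_unitary//.
have -> : P *m H *m (P ^t*)%sesqui =
    ((A *m (P ^t*)%sesqui) ^t*)%sesqui *m (A *m (P ^t*)%sesqui).
  by rewrite trmx_mul map_mxM trmxCK /H !mulmxA.
rewrite mxE; apply: sumr_ge0 => k _; rewrite !mxE.
by rewrite mulrC mul_conjC_ge0.
Qed.

(** The minors and the characteristic polynomial are computed in [F], even if the
    change of basis has its entries in the extension [L]; thus a real symmetric
    matrix may be diagonalised over the complex numbers. *)
Lemma diagonalization_descent (F : fieldType) (L : numFieldType)
    (c : {rmorphism F -> L}) d (G : 'M[F]_d) (D : 'rV[F]_d) (P : 'M[L]_d) :
  P \in unitmx -> map_mx c G = invmx P *m map_mx c (diag_mx D) *m P ->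
  char_poly G = \prod_i ('X - (D 0 i)%:P) /\
  forall m, \sum_(f : {ffun 'I_m -> 'I_d}) \det (mxsub f f G) =
    \sum_(f : {ffun 'I_m -> 'I_d}) \det (mxsub f f (diag_mx D)).
Proof.
move=> Punit GE; split=> [|m].
  apply: (map_poly_inj c); rewrite map_char_poly rmorph_prod.
  rewrite (char_poly_similar (mulVmx Punit) GE) map_diag_mx.
  rewrite char_poly_trig ?diag_mx_is_trig//.
  apply: eq_bigr => i _; rewrite rmorphB/= map_polyX map_polyC/=.
  by rewrite !mxE eqxx mulr1n.
apply: (fmorph_inj c); rewrite !rmorph_sum.
transitivity (\sum_(f : {ffun 'I_m -> 'I_d}) \det (mxsub f f (map_mx c G))).
  by apply: eq_bigr => f _; rewrite -[LHS]det_map_mx map_mxsub.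
transitivity
    (\sum_(f : {ffun 'I_m -> 'I_d}) \det (mxsub f f (map_mx c (diag_mx D))));
  last by apply: eq_bigr => f _; rewrite -[RHS]det_map_mx map_mxsub.
have m0 : (m`!)%:R != 0 :> L by rewrite pnatr_eq0 -lt0n fact_gt0.
apply: (mulfI m0); rewrite GE -mulmxA principal_minors_mulC.
by rewrite -mulmxA mulmxV// mulmx1.
Qed.

Variables (R : realType) (d : nat).
Implicit Types M : 'M[R]_d.

Lemma gram_spectrum M : exists D : 'rV[R]_d,
  [/\ forall i, 0 <= D 0 i,
      char_poly (M^T *m M) = \prod_i ('X - (D 0 i)%:P)
    & forall m, \sum_(f : {ffun 'I_m -> 'I_d}) \det (mxsub f f (M^T *m M)) =
        \sum_(f : {ffun 'I_m -> 'I_d}) \det (mxsub f f (diag_mx D))].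
Proof.
pose c : {rmorphism R -> R[i]} := real_complex R.
pose H := map_mx c (M^T *m M); pose Mc := map_mx c M.
have McE : (Mc ^t*)%sesqui = Mc^T.
  by apply/matrixP => a b; rewrite !mxE; exact: conjc_real.
have HE : H = (Mc ^t*)%sesqui *m Mc by rewrite McE /H map_mxM map_trmx.
have [] := spectral_gram Mc; rewrite -HE.
have Punit := spectral_unit H.
move: (spectralmx H) (spectral_diag H) Punit => P dl Punit Hsp dl0.
pose D : 'rV[R]_d := map_mx (@complex.Re R) dl.
have dlD : dl = map_mx c D.
  by apply/rowP => i; rewrite !mxE; apply/esym/RRe_real; exact: ger0_real.
have D0 i : 0 <= D 0 i by move: (dl0 i); rewrite dlD !mxE ler0c.
have diagD : diag_mx dl = map_mx c (diag_mx D) by rewrite dlD map_diag_mx.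
rewrite diagD in Hsp.
have [pE mE] := diagonalization_descent (c := c) Punit Hsp.
by exists D; split.
Qed.

Lemma mup_prod_XsubC (F : fieldType) (x : F) (s : seq F) :
  mup x (\prod_(a <- s) ('X - a%:P)) = count_mem x s.
Proof.
elim: s => [|a s IH]; first by rewrite big_nil mupNroot// root1.
rewrite big_cons mupM ?polyXsubC_eq0 ?monic_neq0 ?monic_prod_XsubC// IH /=.
by congr (_ + _)%N; rewrite -['X - a%:P]expr1 mup_XsubCX eq_sym; case: eqP.
Qed.

Lemma sorted_flatten_nseq (k : R -> nat) (s : seq R) :
  sorted <=%R s -> sorted <=%R (flatten [seq nseq (k x) x | x <- s]).
Proof.
have pn (n : nat) (x : R) : pairwise <=%R (nseq n x).
  elim: n => //= n ->; rewrite andbT; apply/allP => y /nseqP[-> _]; exact: lexx.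
rewrite !le_sorted_pairwise; elim: s => //= x s IH /andP[xs /IH{}IH].
rewrite pairwise_cat pn IH !andbT; apply/allrelP => y z /nseqP[-> _].
move=> /flattenP[/= l /mapP[w ws ->] /nseqP[-> _]].
exact: (allP xs).
Qed.

(** The list on the left is the one from which [singular_values] is built. *)
Lemma roots_with_multiplicity (s : seq R) (p := \prod_(a <- s) ('X - a%:P)) :
  perm_eq (flatten [seq nseq (mup x p) x | x <- rootsR p]) s.
Proof.
have p0 : p != 0 by rewrite monic_neq0// monic_prod_XsubC.
apply: perm_trans (perm_count_undup s).
have -> : [seq nseq (mup x p) x | x <- rootsR p] =
    [seq nseq (count_mem x s) x | x <- rootsR p].
  by apply: eq_map => x; rewrite mup_prod_XsubC.
apply/perm_flatten/perm_map/uniq_perm.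
- by apply: lt_sorted_uniq; exact: sorted_roots.
- exact: undup_uniq.
- move=> x; rewrite mem_undup -(roots_on_rootsR p0) root_prod_XsubC.
  by rewrite in_itv.
Qed.

Definition gram_roots M : seq R :=
  let p := char_poly (M^T *m M) in
  flatten [seq nseq (mup x p) x | x <- rootsR p].

Lemma singular_valuesE M :
  singular_values M = [seq Num.sqrt x | x <- rev (gram_roots M)].
Proof. by rewrite map_rev. Qed.

Lemma sing_valE M i : sing_val M i = Num.sqrt (nth 0 (rev (gram_roots M)) i).
Proof.
rewrite /sing_val singular_valuesE.
have [lt|ge] := ltnP i (size (rev (gram_roots M))); first exact: nth_map.
by rewrite !nth_default ?sqrtr0 ?size_map.
Qed.

Lemma sing_val_ge0 M i : 0 <= sing_val M i.
Proof. by rewrite sing_valE sqrtr_ge0. Qed.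

Lemma sing_val_le M i j : (i <= j)%N -> sing_val M j <= sing_val M i.
Proof.
move=> ij; have [lt|ge] := ltnP j (size (singular_values M)); last first.
  by rewrite {1}/sing_val nth_default// sing_val_ge0.
have srt : sorted >=%R (singular_values M).
  rewrite rev_sorted; apply: (homo_sorted (e := <=%R)); first exact: ler_wsqrtr.
  apply: sorted_flatten_nseq.
  set q := char_poly _.
  have : sorted <%R (rootsR q) by exact: sorted_roots.
  by apply: sub_sorted => x y; exact: ltW.
apply: (sorted_leq_nth _ _ 0 srt) => //; rewrite ?inE//.
- by move=> x y z /= yx xz; exact: le_trans xz yx.
- exact: lexx.
- exact: leq_ltn_trans lt.
Qed.

(** The spectrum of the Gram matrix in the order of the singular values; sorting
    it only reindexes the product and the sum of principal minors. *)
Lemma gram_sing_val M :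
  char_poly (M^T *m M) = \prod_(i < d) ('X - (sing_val M i ^+ 2)%:P) /\
  forall m, \sum_(f : {ffun 'I_m -> 'I_d}) \det (mxsub f f (M^T *m M)) =
    \sum_(f : {ffun 'I_m -> 'I_d})
      \det (mxsub f f (diag_mx (\row_(i < d) (sing_val M i ^+ 2)))).
Proof.
have [D [D0 pE mE]] := gram_spectrum M.
have pE' : char_poly (M^T *m M) = \prod_(a <- [tuple D 0 i | i < d]) ('X - a%:P).
  by rewrite pE big_tuple; apply: eq_bigr => i _; rewrite tnth_mktuple.
have : perm_eq (rev (gram_roots M)) [tuple D 0 i | i < d].
  by rewrite perm_rev /gram_roots pE'; exact: roots_with_multiplicity.
move=> /tuple_permP[s sE].
have svE (i : 'I_d) : sing_val M i ^+ 2 = D 0 (s i).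
  by rewrite sing_valE sE -tnth_nth !tnth_mktuple sqr_sqrtr.
split=> [|m].
  rewrite pE (reindex_inj (@perm_inj _ s)); apply: eq_bigr => i _.
  by rewrite svE.
rewrite mE; pose sf (f : {ffun 'I_m -> 'I_d}) : {ffun 'I_m -> 'I_d} :=
  [ffun i => s (f i)].
have sfI : injective sf.
  move=> f g /ffunP fg; apply/ffunP => i; have := fg i.
  by rewrite !ffunE => /perm_inj.
rewrite (reindex_inj sfI); apply: eq_bigr => f _; congr (\det _).
apply/matrixP => i j; rewrite !mxE !ffunE svE.
by rewrite (inj_eq (@perm_inj _ s)).
Qed.

(** Compares the constant coefficients of the characteristic polynomial. *)
Lemma abs_det_sing_val M : `|\det M| = \prod_(i < d) sing_val M i.
Proof.
have [pE _] := gram_sing_val M.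
have P0 : 0 <= \prod_(i < d) sing_val M i.
  by apply: prodr_ge0 => i _; exact: sing_val_ge0.
apply/eqP; rewrite -(@eqrXn2 _ 2)// real_normK ?num_real// -prodrXl.
have := char_poly_det (M^T *m M); rewrite -horner_coef0 pE horner_prod.
under eq_bigr do rewrite hornerXsubC sub0r.
rewrite prodrN card_ord det_mulmx det_tr -expr2 => /mulfI h.
by apply/eqP/esym/h; rewrite signr_eq0.
Qed.

(** An eigenvector of the Gram matrix; this is how bounds on the norms of the
    images of vectors pass to singular values. *)
Lemma sing_val_eigenvector M (i : 'I_d) :
  exists2 v : 'cV[R]_d, v != 0 & enorm (M *m v) = sing_val M i * enorm v.
Proof.
have [pE _] := gram_sing_val M.
have : eigenvalue (M^T *m M) (sing_val M i ^+ 2).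
  rewrite eigenvalue_root_char pE; apply/rootP.
  by rewrite horner_prod (bigD1 i)//= hornerXsubC subrr mul0r.
move=> /eigenvalueP[v vE v0]; exists v^T.
  by apply: contra_neq v0 => h; rewrite -[v]trmxK h trmx0.
have enormE (u : 'cV[R]_d) : enorm u = Num.sqrt ((u^T *m u) 0 0).
  by congr Num.sqrt; rewrite mxE; apply: eq_bigr => j _; rewrite mxE expr2.
rewrite !enormE trmx_mul trmxK mulmxA -[v *m _ *m _]mulmxA vE -scalemxAl mxE.
by rewrite sqrtrM ?sqr_ge0// sqrtr_sqr ger0_norm ?sing_val_ge0.
Qed.

End GramSpectrum.

Section MinorsAndSingularValues.
Variables (R : realType) (d : nat).
Implicit Types M : 'M[R]_d.

(** By injectivity some value of [f] is at least [m]; removing its argument lowers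
    [m] by one. *)
Lemma prod_inj_le (b : nat -> R) m (f : 'I_m -> nat) : injective f ->
  (forall i, 0 <= b i) -> (forall i j, (i <= j)%N -> b j <= b i) ->
  \prod_i b (f i) <= \prod_(i < m) b i.
Proof.
move=> + b0 bmono; elim: m f => [|m IH] f finj; first by rewrite !big_ord0.
have [i0 mi0] : exists i0, (m <= f i0)%N.
  apply: contrapT => h.
  have fm i : (f i < m)%N by rewrite ltnNge; apply/negP => mi; apply: h; exists i.
  pose g i : 'I_m := Ordinal (fm i).
  have ginj : injective g by move=> i j /(congr1 val)/= /finj.
  by have := leq_card g ginj; rewrite !card_ord ltnn.
rewrite (bigD1_ord i0)//= big_ord_recr/= mulrC ler_pM ?prodr_ge0 ?bmono//.
by apply: IH => i j /finj /lift_inj.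
Qed.

Lemma det_mxsub_diag m (f : 'I_m -> 'I_d) (b : 'rV[R]_d) :
  \det (mxsub f f (diag_mx b)) =
  if injectiveb f then \prod_i b 0 (f i) else 0.
Proof.
case: injectiveP => [finj|fN].
  rewrite -[X in \det X](_ : diag_mx (\row_i b 0 (f i)) = _).
    by rewrite det_diag; apply: eq_bigr => i _; rewrite mxE.
  by apply/matrixP => i j; rewrite !mxE (inj_eq finj).
have [i [j [ij fij]]] : exists i j, i != j /\ f i = f j.
  apply: contrapT => h; apply: fN => i j fij; apply/eqP/negPn/negP => ij.
  by apply: h; exists i, j.
by apply: (determinant_alternate ij) => k; rewrite !mxE fij.
Qed.

(** The sum of the squared minors of order [m] is, up to the factor [m`!], the sum
    of the principal minors of [M^T *m M]. The latter can be read off from a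
    diagonal form: it is a sum of products of [m] squared singular values, the
    largest of which is the square of the left-hand product. *)
Lemma minor_norm_sing_val m : (m <= d)%N -> exists2 C : R, 0 < C & forall M,
  \prod_(i < m) sing_val M i <= C * minor_norm m M /\
  minor_norm m M <= C * \prod_(i < m) sing_val M i.
Proof.
move=> md; pose c := #|{ffun 'I_m -> 'I_d}|%:R : R; pose fm := (m`!)%:R : R.
have c0 : 0 <= c by [].
have fm1 : 1 <= fm by rewrite ler1n fact_gt0.
have fm0 : 0 < fm by exact: lt_le_trans fm1.
exists (fm + c * (c * (fm * c))) => [|M].
  by rewrite ltr_pwDl// !mulr_ge0// ltW.
set P := \prod_(i < m) _.
have P0 : 0 <= P by apply: prodr_ge0 => i _; exact: sing_val_ge0.
pose L := \sum_(f : {ffun 'I_m -> 'I_d}) \sum_(g : {ffun 'I_m -> 'I_d})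
  `|\det (mxsub f g M)|.
have L0 : 0 <= L by do 2![apply: sumr_ge0 => ? _].
have NL : minor_norm m M = L / fm.
  rewrite mulr_suml; apply: eq_bigr => f _; rewrite mulr_suml.
  by apply: eq_bigr => g _; rewrite normrM normfV [`|m`!%:R|]ger0_norm.
pose S2 := \sum_(g : {ffun 'I_m -> 'I_d}) \sum_(f : {ffun 'I_m -> 'I_d})
  \det (mxsub f g M) ^+ 2.
pose Dg := diag_mx (\row_(i < d) (sing_val M i ^+ 2)).
have S2E : S2 = fm * \sum_(g : {ffun 'I_m -> 'I_d}) \det (mxsub g g Dg).
  rewrite -(gram_sing_val M).2 mulr_sumr; apply: eq_bigr => g _.
  rewrite cauchy_binet_mxsub; apply: eq_bigr => f _.
  by rewrite expr2 -[in X in X * _ = _]det_tr; congr (\det _ * _);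
    apply/matrixP => i j; rewrite !mxE.
have Dg0 (g : {ffun 'I_m -> 'I_d}) : 0 <= \det (mxsub g g Dg).
  rewrite det_mxsub_diag; case: ifP => // _; apply: prodr_ge0 => i _.
  by rewrite mxE sqr_ge0.
have DgP (g : {ffun 'I_m -> 'I_d}) : \det (mxsub g g Dg) <= P ^+ 2.
  rewrite det_mxsub_diag; case: injectiveP => [ginj|_]; last exact: sqr_ge0.
  rewrite -prodrXl; under eq_bigr do rewrite mxE.
  apply: (@prod_inj_le (fun i => sing_val M i ^+ 2) _ (fun i => g i)).
  - by move=> i j /val_inj /ginj.
  - by move=> i; exact: sqr_ge0.
  - by move=> i j ij; rewrite lerXn2r ?nnegrE ?sing_val_ge0 ?sing_val_le.
have PS : P ^+ 2 <= S2.
  pose g0 : {ffun 'I_m -> 'I_d} := [ffun i => widen_ord md i].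
  have g0inj : injective g0.
    by move=> i j /(congr1 val); rewrite !ffunE /= => /val_inj.
  rewrite S2E (@le_trans _ _ (1 * \det (mxsub g0 g0 Dg)))//.
    rewrite mul1r det_mxsub_diag; case: injectiveP => // _.
    rewrite -prodrXl le_eqVlt; apply/orP; left; apply/eqP.
    by apply: eq_bigr => i _; rewrite mxE ffunE.
  rewrite ler_pM//; rewrite (bigD1 g0)//= lerDl.
  by apply: sumr_ge0 => g _.
have SP : S2 <= (fm * c * P) ^+ 2.
  have [c00|c_gt0] := posnP #|{ffun 'I_m -> 'I_d}|.
    rewrite S2E big1 ?mulr0 ?sqr_ge0// => g _.
    by have := card0_eq c00 g; rewrite inE.
  have c1 : 1 <= c by rewrite ler1n.
  rewrite S2E (@le_trans _ _ (fm * (c * P ^+ 2)))//.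
    rewrite ler_pM2l// (le_trans (ler_sum _ (fun g _ => DgP g)))//.
    by rewrite sumr_const -mulr_natl.
  rewrite exprMn exprMn mulrA ler_wpM2r ?sqr_ge0//.
  by rewrite ler_pM ?(ltW fm0) ?ler_eXnr.
have detS (f g : {ffun 'I_m -> 'I_d}) : \det (mxsub f g M) ^+ 2 <= S2.
  rewrite /S2 (bigD1 g)//= (bigD1 f)//= -addrA lerDl addr_ge0// sumr_ge0//.
    by move=> h _; exact: sqr_ge0.
  by move=> h _; apply: sumr_ge0 => ? _; exact: sqr_ge0.
have LP : L <= c * (c * (fm * c * P)).
  have detP (f g : {ffun 'I_m -> 'I_d}) : `|\det (mxsub f g M)| <= fm * c * P.
    rewrite -(@ler_pXn2r _ 2) ?nnegrE// ?mulr_ge0 ?(ltW fm0)//.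
    by rewrite real_normK ?num_real// (le_trans (detS f g)).
  apply: (@le_trans _ _ (\sum_(f : {ffun 'I_m -> 'I_d})
      \sum_(g : {ffun 'I_m -> 'I_d}) fm * c * P)).
    by do 2![apply: ler_sum => ? _]; exact: detP.
  by rewrite !sumr_const -[leLHS]mulr_natl -[X in _ * X]mulr_natl.
have PL : P <= L.
  rewrite -(@ler_pXn2r _ 2) ?nnegrE// (le_trans PS)//.
  rewrite expr2 {1}/L mulr_suml /S2 exchange_big; apply: ler_sum => f _.
  rewrite mulr_suml; apply: ler_sum => g _.
  rewrite -[leLHS]real_normK ?num_real// expr2 ler_wpM2l//.
  rewrite /L (bigD1 f)//= (bigD1 g)//= -addrA lerDl addr_ge0// sumr_ge0//.
  by move=> h _; apply: sumr_ge0.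
have cc0 : 0 <= c * (c * (fm * c)) by rewrite !mulr_ge0// ltW.
rewrite NL; split.
  rewrite mulrDl mulrCA divff ?gt_eqF// mulr1 (le_trans PL)// lerDl.
  by rewrite mulr_ge0// divr_ge0// ltW.
rewrite ler_pdivrMr// (le_trans LP)//.
have -> : c * (c * (fm * c * P)) = c * (c * (fm * c)) * P by ring.
rewrite -[leLHS]mulr1 ler_pM ?mulr_ge0 ?(ltW fm0)//.
by rewrite ler_wpM2r// lerDr ltW.
Qed.

End MinorsAndSingularValues.

(** * The singular value function *)

Section Exponents.
Variables (R : realType) (d : nat).
Implicit Types (s : R) (i m : nat) (M : 'M[R]_d).

(** The exponent of the [i]-th singular value in [svf s]. Monotonicity and
    convexity in [s] are statements about these exponents alone. *)
Definition expo s i : R :=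
  if s <= d%:R then Num.min 1 (Num.max 0 (s - i%:R)) else s / d%:R.

Lemma expo_piece s i m : (m < d)%N -> m%:R <= s <= m%:R + 1 ->
  expo s i = if (i < m)%N then 1 else if i == m then s - m%:R else 0.
Proof.
move=> md /andP[ms sm].
have sd : s <= d%:R.
  by rewrite (le_trans sm)// natr1 ler_nat.
rewrite /expo sd; have [im|mi] := ltnP i m.
  have : i%:R + 1 <= s by rewrite (le_trans _ ms)// natr1 ler_nat.
  by move=> h; rewrite min_l// le_max; apply/orP; right; lra.
have [->|im] := eqVneq i m.
  by rewrite max_r ?subr_ge0// min_r//; lra.
have : m%:R + 1 <= i%:R :> R.
  by rewrite natr1 ler_nat ltn_neqAle eq_sym im.
by move=> h; rewrite max_l ?min_r//; lra.
Qed.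

Lemma expo_large s i : (i < d)%N -> d%:R <= s -> expo s i = s / d%:R.
Proof.
move=> id ds; rewrite /expo; case: ifP => // sd.
have -> : s = d%:R by apply/eqP; rewrite eq_le ds sd.
rewrite divff ?pnatr_eq0 -?lt0n ?(leq_ltn_trans _ id)//.
have : i%:R + 1 <= d%:R :> R by rewrite natr1 ler_nat.
by move=> h; rewrite min_l// le_max; apply/orP; right; lra.
Qed.

Lemma expo_ge0 s i : 0 <= s -> 0 <= expo s i.
Proof.
move=> s0; rewrite /expo; case: ifP => _; last by rewrite divr_ge0.
by rewrite le_min ler01/= le_max lexx.
Qed.

Lemma expo_le s s' i : (0 < d)%N -> s <= s' -> expo s i <= expo s' i.
Proof.
move=> d0 ss'; rewrite /expo; case: ifPn => sd; case: ifPn => sd'.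
- by rewrite le_min ge_min lexx/= ge_min ge_max !le_max lexx/= lerB// orbT orbT.
- rewrite ge_min; apply/orP; left; rewrite ler_pdivlMr ?ltr0n// mul1r.
  by apply/ltW; rewrite ltNge.
- by case/negP: sd; exact: le_trans sd'.
- by rewrite ler_pM2r// invr_gt0 ltr0n.
Qed.

Lemma sum_clamp n s : 0 <= s ->
  \sum_(i < n) Num.min 1 (Num.max 0 (s - i%:R)) = Num.min n%:R s.
Proof.
move=> s0; elim: n => [|n IH]; first by rewrite big_ord0 min_l.
rewrite big_ord_recr/= IH -natr1.
have [ns|sn] := lerP n%:R s.
  rewrite max_r ?subr_ge0//; have [h|h] := lerP 1 (s - n%:R);
    have [h'|h'] := lerP (n%:R + 1) s; lra.
rewrite max_l; last by lra.
rewrite [Num.min 1 0]min_r// addr0 min_r//; lra.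
Qed.

Lemma sum_expo s : (0 < d)%N -> 0 <= s -> \sum_(i < d) expo s i = s.
Proof.
move=> d0 s0; have [sd|ds] := lerP s d%:R.
  by under eq_bigr do rewrite /expo sd; rewrite sum_clamp// min_r.
under eq_bigr do rewrite /expo leNgt ds /=.
by rewrite sumr_const card_ord -[LHS]mulr_natl mulrCA divff ?mulr1// pnatr_eq0 -lt0n.
Qed.

Definition gsvf (e : nat -> R) M := \prod_(i < d) sing_val M i `^ e i.

Lemma gsvf_ge0 e M : 0 <= gsvf e M.
Proof. by apply: prodr_ge0 => i _; exact: powR_ge0. Qed.

Lemma svf_piece s m M : (m <= d)%N -> m%:R <= s < m%:R + 1 -> s <= d%:R ->
  svf s M = (\prod_(i < m) sing_val M i) * sing_val M m `^ (s - m%:R).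
Proof.
move=> md ms sd; rewrite /svf sd (_ : Num.truncn s = m)//.
by apply/truncn_def; rewrite -natr1.
Qed.

Lemma svfE s M : (0 < d)%N -> 0 <= s -> svf s M = gsvf (expo s) M.
Proof.
move=> d0 s0; have [sd|ds] := lerP s d%:R; last first.
  rewrite /svf leNgt ds/= abs_det_sing_val powR_prodl; last exact: sing_val_ge0.
  by apply: eq_bigr => i _; rewrite expo_large// ltW.
pose m := Num.truncn s.
have /andP[ms sm] : m%:R <= s < m%:R + 1 by rewrite natr1; exact: truncn_itv.
have md : (m <= d)%N by rewrite -(ler_nat R) (le_trans ms).
rewrite (svf_piece M md)// ?ms//; have [md'|dm] := ltnP m d; last first.
  have dmE : m = d by apply/eqP; rewrite eqn_leq md.
  have sE : s = d%:R by apply/eqP; rewrite eq_le sd -{1}dmE ms.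
  rewrite sE dmE subrr powRr0 mulr1; apply: eq_bigr => i _.
  by rewrite expo_large// divff ?powRr1 ?sing_val_ge0// pnatr_eq0 -lt0n.
have eE i : expo s i = _ := expo_piece i md' (introT andP (conj ms (ltW sm))).
rewrite /gsvf -(big_mkord xpredT (fun i => sing_val M i `^ expo s i)).
rewrite (big_cat_nat (n := m))// (big_ltn md')/= big_mkord.
rewrite eE ltnn eqxx [X in _ = _ * (_ * X)]big1_seq ?mulr1.
  congr (_ * _); apply: eq_bigr => i _.
  by rewrite eE ltn_ord powRr1// sing_val_ge0.
move=> i; rewrite mem_index_iota => /andP[_ /andP[mi _]].
by rewrite eE ltnNge ltnW//= gtn_eqF// powRr0.
Qed.

Lemma svf_ge0 s M : (0 < d)%N -> 0 <= s -> 0 <= svf s M.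
Proof. by move=> d0 s0; rewrite svfE// gsvf_ge0. Qed.

(** The exponents increase by [s' - s] in total. *)
Lemma svf_le s s' M (a : R) : (0 < d)%N -> 0 <= s -> s <= s' ->
  (forall i, (i < d)%N -> sing_val M i <= a) -> svf s' M <= a `^ (s' - s) * svf s M.
Proof.
move=> d0 s0 ss' aM; have s'0 : 0 <= s' by exact: le_trans ss'.
have de i : 0 <= expo s' i - expo s i by rewrite subr_ge0 expo_le.
have -> : s' - s = \sum_(i < d) (expo s' i - expo s i).
  by rewrite sumrB !sum_expo.
rewrite !svfE// powR_sumr//.
rewrite -big_split/=; apply: ler_prod => i _; rewrite powR_ge0/=.
rewrite -{1}[expo s' i](subrK (expo s i)) [X in X <= _]powRD_nneg ?expo_ge0//.
rewrite ler_wpM2r ?powR_ge0// ge0_powR_le ?sing_val_ge0//.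
exact: aM.
Qed.

Lemma svf_ge s s' M (a : R) : (0 < d)%N -> 0 <= s -> s <= s' -> 0 <= a ->
  (forall i, (i < d)%N -> a <= sing_val M i) -> a `^ (s' - s) * svf s M <= svf s' M.
Proof.
move=> d0 s0 ss' a0 aM; have s'0 : 0 <= s' by exact: le_trans ss'.
have de i : 0 <= expo s' i - expo s i by rewrite subr_ge0 expo_le.
have -> : s' - s = \sum_(i < d) (expo s' i - expo s i).
  by rewrite sumrB !sum_expo.
rewrite !svfE// powR_sumr//.
rewrite -big_split/=; apply: ler_prod => i _.
apply/andP; split; first by rewrite mulr_ge0 ?powR_ge0.
rewrite -[in leRHS](subrK (expo s i) (expo s' i)) [leRHS]powRD_nneg ?expo_ge0//.
rewrite ler_wpM2r ?powR_ge0// ge0_powR_le//.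
exact: aM.
Qed.

(** On an interval where the exponents are affine, the logarithm of [gsvf] is
    affine. *)
Lemma gsvf_mix e0 e1 e (l : R) M : 0 < l < 1 ->
  (forall i, (i < d)%N -> 0 <= e0 i) -> (forall i, (i < d)%N -> 0 <= e1 i) ->
  (forall i, (i < d)%N -> e i = l * e0 i + (1 - l) * e1 i) ->
  gsvf e M = gsvf e0 M `^ l * gsvf e1 M `^ (1 - l).
Proof.
move=> /andP[l0 l1] e00 e10 eE.
rewrite /gsvf !powR_prodl; [|by move=> i; exact: powR_ge0..].
rewrite -big_split/=; apply: eq_bigr => i _.
rewrite eE// powRD_nneg ?mulr_ge0 ?e00 ?e10 ?subr_ge0 ?(ltW l0) ?(ltW l1)//.
by rewrite -!powRrM [l * _]mulrC [(1 - l) * _]mulrC.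
Qed.

End Exponents.

Section Comparison.
Variables (R : realType) (d : nat).
Hypothesis d0 : (0 < d)%N.
Implicit Types (s : R) (g h : 'M[R]_d -> R).

Definition same_order g h := exists2 C : R, 0 < C &
  forall M, g M <= C * h M /\ h M <= C * g M.

Lemma same_order_trans g h f : same_order g h -> same_order h f -> same_order g f.
Proof.
move=> [C C0 gh] [C' C'0 hf]; exists (C * C'); first exact: mulr_gt0.
move=> M; have [g1 g2] := gh M; have [h1 h2] := hf M; split.
  by rewrite (le_trans g1)// -mulrA ler_pM2l.
by rewrite (le_trans h2)// [C * C']mulrC -mulrA ler_pM2l.
Qed.

Lemma same_order_powR g h (p : R) : 0 <= p -> (forall M, 0 <= g M) ->
  (forall M, 0 <= h M) -> same_order g h ->
  same_order (fun M => g M `^ p) (fun M => h M `^ p).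
Proof.
move=> p0 g0 h0 [C C0 gh]; exists (C `^ p) => [|M]; first exact: powR_gt0.
have [g1 g2] := gh M.
by split; rewrite -powRM ?(ltW C0)// ge0_powR_le.
Qed.

Lemma same_orderM g g' h h' : (forall M, 0 <= g M) -> (forall M, 0 <= h M) ->
  (forall M, 0 <= g' M) -> (forall M, 0 <= h' M) ->
  same_order g h -> same_order g' h' ->
  same_order (fun M => g M * g' M) (fun M => h M * h' M).
Proof.
move=> g0 h0 g'0 h'0 [C C0 gh] [C' C'0 gh'].
exists (C * C') => [|M]; first exact: mulr_gt0.
have [g1 g2] := gh M; have [g1' g2'] := gh' M.
by split; rewrite mulrACA ler_pM.
Qed.

(** Interpolates between the products of the [m] and of the [m.+1] largest
    singular values. For [m = d] the second factor has exponent 0. *)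
Lemma svf_same_order s m : (m <= d)%N -> m%:R <= s < m%:R + 1 -> s <= d%:R ->
  same_order (@svf R d s) (fun M => minor_norm m M `^ (1 - (s - m%:R)) *
                              minor_norm m.+1 M `^ (s - m%:R)).
Proof.
move=> md /andP[ms sm] sd; set t := s - m%:R.
have t0 : 0 <= t by rewrite subr_ge0.
have t1 : 0 < 1 - t by rewrite /t; lra.
have a0 M i : 0 <= @sing_val R d M i by exact: sing_val_ge0.
have P0 M n : 0 <= \prod_(i < n) @sing_val R d M i by exact: prodr_ge0.
have N0 n (M : 'M[R]_d) : 0 <= minor_norm n M by exact: rep_norm_ge0 (rep_norm_minor _ _ _).
have cmp n : (n <= d)%N ->
    same_order (fun M => \prod_(i < n) @sing_val R d M i) (@minor_norm R d n).
  exact: minor_norm_sing_val.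
apply: (@same_order_trans _ (fun M =>
    (\prod_(i < m) sing_val M i) `^ (1 - t) *
    (\prod_(i < m.+1) sing_val M i) `^ t)).
  exists 1 => // M; rewrite !mul1r (svf_piece M md)// ?ms// -/t.
  have -> : (\prod_(i < m) sing_val M i) `^ (1 - t) *
      (\prod_(i < m.+1) sing_val M i) `^ t =
      (\prod_(i < m) sing_val M i) * sing_val M m `^ t.
    rewrite [X in _ * X `^ t = _]big_ord_recr/= [X in _ * X = _]powRM ?P0// mulrA -powRD_nneg ?(ltW t1)//.
    by rewrite subrK powRr1 ?P0.
  by split.
apply: same_orderM => [M|M|M|M||]; rewrite ?powR_ge0//.
  by apply: same_order_powR; rewrite ?(ltW t1)//; exact: cmp.
have [md'|dm] := ltnP m d; first by apply: same_order_powR => //; exact: cmp.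
have -> : t = 0.
  apply/eqP; rewrite eq_le t0 andbT /t subr_le0 (le_trans sd)// ler_nat//.
by exists 1 => // M; rewrite !powRr0 mulr1.
Qed.

(** The minor norms are submultiplicative, being representation norms. *)
Lemma svf_quasi_submult s : 0 <= s -> exists2 C, 0 < C &
  forall X Y : 'M[R]_d, svf s (X *m Y) <= C * svf s X * svf s Y.
Proof.
move=> s0; have [sd|ds] := lerP s d%:R; last first.
  exists 1 => // X Y; rewrite mul1r /svf [s <= _]leNgt ds/=.
  by rewrite det_mulmx normrM powRM.
pose m := Num.truncn s.
have /andP[ms sm] : m%:R <= s < m%:R + 1 by rewrite natr1; exact: truncn_itv.
have md : (m <= d)%N by rewrite -(ler_nat R) (le_trans ms).
have [|C C0] := svf_same_order md _ sd; first by rewrite ms.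
move=> cmp; pose Psi (M : 'M[R]_d) := minor_norm m M `^ (1 - (s - m%:R)) *
  minor_norm m.+1 M `^ (s - m%:R).
have {}cmp (M : 'M[R]_d) : svf s M <= C * Psi M /\ Psi M <= C * svf s M := cmp M.
exists (C * (C * C)); first by do ![apply: mulr_gt0].
have t0 : 0 <= s - m%:R by rewrite subr_ge0.
have t1 : 0 <= 1 - (s - m%:R) by lra.
have N0 n (M : 'M[R]_d) : 0 <= minor_norm n M by exact: rep_norm_ge0 (rep_norm_minor _ _ _).
have NM n (X Y : 'M[R]_d) : minor_norm n (X *m Y) <= minor_norm n X * minor_norm n Y.
  exact: rep_norm_submult (rep_norm_minor _ _ _).
have Psi0 M : 0 <= Psi M by rewrite mulr_ge0 ?powR_ge0.
move=> X Y; rewrite (le_trans (cmp _).1)// -!mulrA ler_pM2l//.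
rewrite (@le_trans _ _ (Psi X * Psi Y))//.
  by rewrite /Psi mulrACA -!powRM// ler_pM ?powR_ge0 ?ge0_powR_le.
have -> : C * (C * (svf s X * svf s Y)) = (C * svf s X) * (C * svf s Y) by ring.
by rewrite ler_pM ?(cmp _).2.
Qed.

(** The parameters at which [svf s] is within constants of a power of a single
    representation norm; they are dense in the nonnegative reals. *)
Definition representable s :=
  (exists a b : nat, (0 < b)%N /\ s * b%:R = a%:R) \/ d%:R < s.

(** If the fractional part of [s] is [a' / b], then [svf s] is within constants of
    the [b]-th root of a product of [b] minor norms, that is, of the norm of a
    Kronecker product of compounds; for [s] above [d] it is a power of the
    determinant. *)
Lemma svf_representable s : 0 <= s -> representable s ->
  exists (N : 'M[R]_d -> R) (p : R), [/\ rep_norm N, 0 < p &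
    same_order (@svf R d s) (fun M => N M `^ p)].
Proof.
move=> s0 rs; have [sd|ds] := lerP s d%:R; last first.
  exists (fun A => `|\det A|), (s / d%:R); split; first exact: rep_norm_det.
    by rewrite divr_gt0 ?ltr0n// (le_lt_trans _ ds).
  by exists 1 => // M; rewrite !mul1r /svf [s <= _]leNgt ds.
case: rs => [[a [b [b0 sb]]]|]; last by rewrite ltNge sd.
pose m := Num.truncn s.
have /andP[ms sm] : m%:R <= s < m%:R + 1 by rewrite natr1; exact: truncn_itv.
have md : (m <= d)%N by rewrite -(ler_nat R) (le_trans ms).
have bR0 : 0 < b%:R :> R by rewrite ltr0n.
have mba : (m * b <= a)%N by rewrite -(ler_nat R) natrM -sb ler_pM2r.
pose a' := (a - m * b)%N.
have tE : s - m%:R = a'%:R / b%:R.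
  by rewrite natrB// natrM -sb mulrBl !mulfK// gt_eqF.
have a'b : (a' <= b)%N.
  rewrite -(ler_nat R) -[leRHS]mul1r -ler_pdivrMr// -tE; lra.
have t1E : 1 - (s - m%:R) = (b - a')%:R / b%:R.
  have bN : b%:R != 0 :> R by rewrite gt_eqF.
  by rewrite tE [(b - a')%:R]natrB//; field.
have N0 n (M : 'M[R]_d) : 0 <= minor_norm n M by exact: rep_norm_ge0 (rep_norm_minor _ _ _).
exists (fun M => minor_norm m M ^+ (b - a') * minor_norm m.+1 M ^+ a'), b%:R^-1.
split; [|by rewrite invr_gt0|].
  by apply: rep_normM; apply: rep_normX; exact: rep_norm_minor.
have [|C C0 cmp] := svf_same_order md _ sd; first by rewrite ms.
exists C => // M; have := cmp M; rewrite t1E tE.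
by rewrite powRM ?exprn_ge0// -!powR_mulrn// -!powRrM.
Qed.

End Comparison.

(** * Euclidean bounds on the singular values of products *)

Section EuclideanBounds.
Variables (R : realType) (d : nat).
Implicit Types (v : 'cV[R]_d) (M : 'M[R]_d).

Lemma enorm_ge0 v : 0 <= enorm v.
Proof. exact: sqrtr_ge0. Qed.

Lemma enorm_entry v i : `|v i 0| <= enorm v.
Proof.
rewrite -sqrtr_sqr ler_wsqrtr// (bigD1 i)//= lerDl sumr_ge0// => j _.
exact: sqr_ge0.
Qed.

Lemma enorm_gt0 v : v != 0 -> 0 < enorm v.
Proof.
move=> v0; rewrite lt_neqAle enorm_ge0 andbT; apply: contra_neq v0 => v0.
apply/colP => i; apply/eqP; rewrite mxE -normr_le0 v0.
exact: enorm_entry.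
Qed.

Lemma enormZ (c : R) v : enorm (c *: v) = `|c| * enorm v.
Proof.
rewrite /enorm -sqrtr_sqr -sqrtrM ?sqr_ge0//; congr Num.sqrt.
by rewrite mulr_sumr; apply: eq_bigr => i _; rewrite mxE exprMn.
Qed.

Lemma enorm_le_l1 v : enorm v <= l1 v.
Proof.
rewrite -[leRHS]ger0_norm ?l1_ge0// -sqrtr_sqr ler_wsqrtr//.
rewrite expr2 {1}l1_col mulr_suml; apply: ler_sum => i _.
by rewrite -real_normK ?num_real// expr2 ler_wpM2l// l1_entry.
Qed.

Lemma enorm_mul M v : enorm (M *m v) <= l1 M * enorm v.
Proof.
rewrite (le_trans (enorm_le_l1 _))// l1_col mulr_suml; apply: ler_sum => i _.
rewrite mxE (le_trans (ler_norm_sum _ _ _))// mulr_suml; apply: ler_sum => j _.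
by rewrite normrM ler_wpM2l// enorm_entry.
Qed.

Lemma enorm_opnorm M v : enorm (M *m v) <= opnorm M * enorm v.
Proof.
have [->|v0] := eqVneq v 0.
  by rewrite mulmx0 -(scale0r (0 : 'cV[R]_d)) enormZ normr0 !mul0r mulr0.
have vp := enorm_gt0 v0; rewrite -ler_pdivrMr//.
apply: ub_le_sup.
  exists (l1 M) => _ [u /= u1 <-]; rewrite (le_trans (enorm_mul _ _))//.
  by rewrite ler_piMr ?l1_ge0.
exists ((enorm v)^-1 *: v) => /=.
  by rewrite enormZ gtr0_norm ?invr_gt0// mulVf// gt_eqF.
by rewrite -scalemxAr enormZ gtr0_norm ?invr_gt0// mulrC.
Qed.

Variables (K : finType) (A : K -> 'M[R]_d).

Lemma sing_val_word_le (c : R) n (w : n.-tuple K) i : 0 <= c ->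
  (forall j v, enorm (A j *m v) <= c * enorm v) -> (i < d)%N ->
  sing_val (\prod_(j <- w) A j) i <= c ^+ n.
Proof.
move=> c0 Ac id; have [v v0 vE] := sing_val_eigenvector (\prod_(j <- w) A j) (Ordinal id).
rewrite -(ler_pM2r (enorm_gt0 v0)) -vE -[in leRHS](size_tuple w).
elim: (tval w) => [|j s IH]; first by rewrite big_nil mul1mx expr0 mul1r.
rewrite big_cons -[A j * _]/(A j *m _) -mulmxA (le_trans (Ac _ _))//= exprS -mulrA.
by rewrite ler_wpM2l.
Qed.

Lemma sing_val_word_ge (c : R) n (w : n.-tuple K) i : 0 <= c ->
  (forall j v, c * enorm v <= enorm (A j *m v)) -> (i < d)%N ->
  c ^+ n <= sing_val (\prod_(j <- w) A j) i.
Proof.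
move=> c0 Ac id; have [v v0 vE] := sing_val_eigenvector (\prod_(j <- w) A j) (Ordinal id).
rewrite -(ler_pM2r (enorm_gt0 v0)) -vE -[in leLHS](size_tuple w).
elim: (tval w) => [|j s IH]; first by rewrite big_nil mul1mx expr0 mul1r.
rewrite big_cons -[A j * _]/(A j *m _) -mulmxA (le_trans _ (Ac _ _))//= exprS -mulrA.
by rewrite ler_wpM2l.
Qed.

End EuclideanBounds.

(** * Convexity of growth rates *)

Section GrowthConvexity.
Variables (R : realType) (d : nat) (K : finType) (A : K -> 'M[R]_d).
Implicit Types (g : 'M[R]_d -> R).

(** Young's inequality word by word, after dividing [g0] by [r0 ^+ n] and [g1] by
    [r1 ^+ n] for rates [r0] and [r1] slightly above the growth rates. *)
Lemma growth_convex g0 g1 g (l b0 b1 : R) : 0 < l < 1 ->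
  (forall X, 0 <= g0 X) -> (forall X, 0 <= g1 X) ->
  (forall X, g X = g0 X `^ l * g1 X `^ (1 - l)) ->
  0 < b0 -> exp_bounded (fun n => wsum A n g0) b0 ->
  0 < b1 -> exp_bounded (fun n => wsum A n g1) b1 ->
  growth (fun n => wsum A n g) <=
    l * growth (fun n => wsum A n g0) + (1 - l) * growth (fun n => wsum A n g1).
Proof.
move=> l01 g00 g10 gE b00 B0 b10 B1; have /andP[l0 l1] := l01.
have l1' : 0 < 1 - l by rewrite subr_gt0.
apply/ler_addgt0Pr => e e0.
set G0 := growth (fun n => wsum A n g0); set G1 := growth (fun n => wsum A n g1).
have [C0 C00 W0] : exp_bounded (fun n => wsum A n g0) (G0 + e).
  by apply: (growth_lt b00 B0); rewrite ltrDl.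
have [C1 C10 W1] : exp_bounded (fun n => wsum A n g1) (G1 + e).
  by apply: (growth_lt b10 B1); rewrite ltrDl.
pose r0 := G0 + e; pose r1 := G1 + e.
have r00 : 0 < r0 by rewrite ltr_wpDl// growth_ge0.
have r10 : 0 < r1 by rewrite ltr_wpDl// growth_ge0.
have -> : l * G0 + (1 - l) * G1 + e = l * r0 + (1 - l) * r1.
  by rewrite /r0 /r1; ring.
have r_gt0 : 0 < l * r0 + (1 - l) * r1 by rewrite addr_gt0// mulr_gt0.
apply: growth_le => //; exists (l * C0 + (1 - l) * C1) => [|n].
  by rewrite addr_gt0// mulr_gt0.
set r := l * r0 + _.
have rn0 : 0 < r0 ^+ n by rewrite exprn_gt0.
have rn1 : 0 < r1 ^+ n by rewrite exprn_gt0.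
have gX X : g X <= (l * (r0 ^+ n)^-1 * g0 X + (1 - l) * (r1 ^+ n)^-1 * g1 X) * r ^+ n.
  have x0 : 0 <= g0 X / r0 ^+ n by rewrite divr_ge0// ltW.
  have y0 : 0 <= g1 X / r1 ^+ n by rewrite divr_ge0// ltW.
  have -> : g X = (g0 X / r0 ^+ n) `^ l * (g1 X / r1 ^+ n) `^ (1 - l) *
      (r0 `^ l * r1 `^ (1 - l)) ^+ n.
    rewrite exprMn (powRX _ _ (ltW r00)) (powRX _ _ (ltW r10)) mulrACA.
    rewrite -(powRM _ x0 (ltW rn0)) -(powRM _ y0 (ltW rn1)).
    by rewrite (divfK (lt0r_neq0 rn0)) (divfK (lt0r_neq0 rn1)).
  rewrite ler_pM ?mulr_ge0 ?powR_ge0 ?exprn_ge0 ?mulr_ge0 ?powR_ge0//.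
    rewrite (le_trans (young _ _ l01))// le_eqVlt; apply/orP; left; apply/eqP.
    by rewrite -!mulrA [_^-1 * g0 X]mulrC [_^-1 * g1 X]mulrC.
  rewrite lerXn2r ?nnegrE ?mulr_ge0 ?powR_ge0 ?(ltW r_gt0)//.
  by apply: young => //; exact: ltW.
rewrite (le_trans (wsum_le A n gX))//.
under eq_fun do rewrite mulrC; rewrite wsumZ wsum_add !wsumZ mulrC.
rewrite ler_wpM2r ?exprn_ge0 ?(ltW r_gt0)// lerD// -mulrA ler_pM2l//.
  by rewrite mulrC ler_pdivrMr// W0.
by rewrite mulrC ler_pdivrMr// W1.
Qed.

End GrowthConvexity.

(** * The growth rate as a function of the matrices and the exponent *)

Section RealFacts.
Variable R : realType.

Lemma convex_gap (r G q l e : R) : 0 <= q -> 0 < e -> 0 < l -> l * (G + e) <= e ->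
  r <= l * G + (1 - l) * q -> r <= q + e.
Proof.
move=> q0 e0 l0; rewrite mulrDr mulrBl mul1r => h1 h2.
have : 0 <= l * q by rewrite mulr_ge0// ltW.
have : 0 <= l * e by rewrite mulr_ge0// ltW.
lra.
Qed.

Lemma dist_halves (x y s dl : R) :
  s - dl / 2 < y -> x < s + dl / 2 -> x - y <= dl.
Proof. lra. Qed.

Lemma two_thirds (x y : R) : x < y -> x + 2 * ((y - x) / 3) < y.
Proof. lra. Qed.

Lemma two_thirdsN (x y : R) : x < y -> x < y - 2 * ((y - x) / 3).
Proof. lra. Qed.

End RealFacts.

Section Rho.
Variables (R : realType) (d : nat) (K : finType).
Hypothesis d0 : (0 < d)%N.
Implicit Types (s q : R) (A : K -> 'M[R]_d).

(** The exponential of the pressure. *)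
Definition rho s A := growth (fun n => wsum A n (@svf R d s)).

Lemma svf_wsum_quasi_submult s A : 0 <= s ->
  exists C, quasi_submult (fun n => wsum A n (@svf R d s)) C.
Proof.
move=> s0; have [C C0 CM] := svf_quasi_submult d s0.
by exists C; apply: wsum_quasi_submult => // X; exact: svf_ge0.
Qed.

Lemma svf_wsum_exp_bounded s A : 0 <= s ->
  exists2 r, 0 < r & exp_bounded (fun n => wsum A n (@svf R d s)) r.
Proof. by move=> s0; have [C /quasi_submult_exp_bounded] := svf_wsum_quasi_submult A s0. Qed.

Lemma rho_ge0 s A : 0 <= rho s A.
Proof. exact: growth_ge0. Qed.

Lemma rho_representable_cvg s (T : Type) (F : set_system T)
    (A : T -> K -> 'M[R]_d) (A0 : K -> 'M[R]_d) : Filter F -> 0 <= s ->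
  representable d s -> (forall i, entry_cvg F (A^~ i) (A0 i)) ->
  rho s (A u) @[u --> F] --> rho s A0.
Proof.
move=> FF s0 rs AA0.
have [N [p [rN p0 [C C0 cmp]]]] := svf_representable d0 s0 rs.
have rhoE B : rho s B = growth (fun n => wsum B n (fun X => N X `^ p)).
  have [r r0 Br] := quasi_submult_exp_bounded (rep_norm_quasi_submult B rN p0).
  by apply: (growth_eqM C0 C0 r0 Br) => n; rewrite -wsumZ; apply: wsum_le => X;
    have [] := cmp X.
by rewrite rhoE; under eq_fun do rewrite rhoE; exact: growth_cvg.
Qed.

Lemma rho_le s s' A (c : R) : 0 <= s -> s <= s' -> 0 < c ->
  (forall j v, enorm (A j *m v) <= c * enorm v) ->
  rho s' A <= c `^ (s' - s) * rho s A.
Proof.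
move=> s0 ss' c0 Ac; have [r r0 Br] := svf_wsum_exp_bounded A s0.
apply: (growth_leM ltr01 _ r0 Br) => [|n]; first exact: powR_gt0.
rewrite mul1r -wsumZ; apply: ler_sum => w _.
rewrite (le_trans (svf_le d0 s0 ss' (a := c ^+ n) _))//.
  by move=> i id; exact: sing_val_word_le (ltW c0) Ac id.
by rewrite powRX// ltW.
Qed.

Lemma rho_ge s s' A (c : R) : 0 <= s -> s <= s' -> 0 < c ->
  (forall j v, c * enorm v <= enorm (A j *m v)) ->
  c `^ (s' - s) * rho s A <= rho s' A.
Proof.
move=> s0 ss' c0 Ac; have s'0 := le_trans s0 ss'.
have [r r0 Br] := svf_wsum_exp_bounded A s'0.
have cs : 0 < c `^ (s' - s) by exact: powR_gt0.
rewrite -ler_pdivlMl//; apply: (growth_leM ltr01 _ r0 Br) => [|n].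
  by rewrite invr_gt0.
rewrite mul1r exprVn ler_pdivlMl ?exprn_gt0// -wsumZ; apply: ler_sum => w _.
rewrite (le_trans _ (svf_ge d0 s0 ss' (a := c ^+ n) _ _))//.
- by rewrite powRX// ltW.
- by rewrite exprn_ge0// ltW.
- by move=> i id; exact: sing_val_word_ge (ltW c0) Ac id.
Qed.

Lemma rho_mix s0 s1 (l : R) A : 0 < l < 1 -> 0 <= s0 -> 0 <= s1 ->
  (forall i, (i < d)%N -> expo d (l * s0 + (1 - l) * s1) i =
     l * expo d s0 i + (1 - l) * expo d s1 i) ->
  rho (l * s0 + (1 - l) * s1) A <= l * rho s0 A + (1 - l) * rho s1 A.
Proof.
move=> l01 s00 s10 eE; have /andP[l0 l1] := l01.
have [r r0 Br] := svf_wsum_exp_bounded A s00.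
have [r' r'0 Br'] := svf_wsum_exp_bounded A s10.
apply: (growth_convex l01 _ _ _ r0 Br r'0 Br') => [X|X|X]; try exact: svf_ge0.
have sm : 0 <= l * s0 + (1 - l) * s1.
  by rewrite addr_ge0// mulr_ge0// ?subr_ge0 ltW.
rewrite !svfE//; apply: gsvf_mix => // i _; exact: expo_ge0.
Qed.

Lemma rho_convex_piece s0 s1 m (l : R) A : 0 < l < 1 -> (m < d)%N ->
  m%:R <= s0 <= m%:R + 1 -> m%:R <= s1 <= m%:R + 1 ->
  rho (l * s0 + (1 - l) * s1) A <= l * rho s0 A + (1 - l) * rho s1 A.
Proof.
move=> l01 md s0m s1m; have m0 : 0 <= m%:R :> R by [].
have /andP[l0 l1] := l01; have /andP[a0 a1] := s0m; have /andP[c0 c1] := s1m.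
have sm : m%:R <= l * s0 + (1 - l) * s1 <= m%:R + 1.
  by apply/andP; split; nra.
apply: rho_mix => //; [lra|lra|move=> i _].
by rewrite !(expo_piece i md)//; case: ifP => _; [ring|case: eqP => _; ring].
Qed.

Lemma rho_convex_large s0 s1 (l : R) A : 0 < l < 1 ->
  d%:R <= s0 -> d%:R <= s1 ->
  rho (l * s0 + (1 - l) * s1) A <= l * rho s0 A + (1 - l) * rho s1 A.
Proof.
move=> l01 ds0 ds1; have m0 : 0 <= d%:R :> R by [].
have /andP[l0 l1] := l01.
have sm : d%:R <= l * s0 + (1 - l) * s1 by nra.
apply: rho_mix => //; [lra|lra|move=> i id].
by rewrite !expo_large//; lra.
Qed.

(** For exponents at least [d], [svf] is a power of the determinant. This power
    makes sense for all positive exponents, which makes [d] an interior point of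
    an interval of convexity. *)
Lemma rho_convex_det s0 A : 0 < s0 -> exists2 G, 0 <= G & forall s1 l,
  0 < l < 1 -> d%:R <= s1 -> d%:R <= l * s0 + (1 - l) * s1 ->
  rho (l * s0 + (1 - l) * s1) A <= l * G + (1 - l) * rho s1 A.
Proof.
move=> s00; have dR : 0 < d%:R :> R by rewrite ltr0n.
pose g (X : 'M[R]_d) := `|\det X| `^ (s0 / d%:R).
exists (growth (fun n => wsum A n g)) => [|s1 l l01 ds1 ds]; first exact: growth_ge0.
have [r r0 Br] := quasi_submult_exp_bounded
  (rep_norm_quasi_submult A (rep_norm_det R d) (divr_gt0 s00 dR)).
have s10 : 0 <= s1 by rewrite (le_trans _ ds1)// ltW.
have [r' r'0 Br'] := svf_wsum_exp_bounded A s10.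
apply: (growth_convex l01 _ _ _ r0 Br r'0 Br') => [X|X|X].
- exact: powR_ge0.
- exact: svf_ge0.
rewrite !svfE ?(le_trans (ltW dR) ds)//.
have -> : `|\det X| `^ (s0 / d%:R) = gsvf (fun=> s0 / d%:R) X.
  by rewrite abs_det_sing_val powR_prodl// => i; exact: sing_val_ge0.
apply: gsvf_mix => // i id; first by rewrite divr_ge0// ltW.
- exact: expo_ge0.
- by rewrite !expo_large// mulrDl !mulrA.
Qed.

Lemma representable_ratr (q : rat) : 0 <= ratr q :> R -> representable d (ratr q : R).
Proof.
rewrite ler0q => q0; left; exists `|numq q|%N, `|denq q|%N; split.
  by rewrite absz_gt0 denq_neq0.
rewrite -[X in X * _]/(ratr q) /ratr.
have -> : (`|denq q|%N)%:R = (denq q)%:~R :> R.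
  by rewrite -[RHS]/((denq q)%:~R) -{2}(absz_denq q).
have -> : (`|numq q|%N)%:R = (numq q)%:~R :> R.
  by rewrite -{2}[numq q]gez0_abs// numq_ge0.
by rewrite divfK// intr_eq0 denq_neq0.
Qed.

Lemma exists_representable (x y : R) : 0 <= x -> x < y ->
  exists2 q, x < q < y & representable d q.
Proof.
move=> x0 /rat_in_itvoo[q]; rewrite in_itv/= => /andP[xq qy].
exists (ratr q); rewrite ?xq//; apply: representable_ratr.
by rewrite ltW// (le_lt_trans x0).
Qed.

(** Convexity on an interval ending at [s] bounds [rho] from above to the left of
    [s]. At [s = 0] the only choice is [q = 0]. *)
Lemma rho_left s A (e dl : R) : 0 <= s -> 0 < e -> 0 < dl ->
  exists q, [/\ 0 <= q, q = s \/ q < s, s - dl < q, representable d q & (q = s -> s = 0) /\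
    rho q A <= rho s A + e].
Proof.
move=> s0 e0 dl0; have [s_le0|s_gt0] := lerP s 0.
  have -> : s = 0 by apply/eqP; rewrite eq_le s_le0.
  exists 0; split=> //; [by left|by rewrite sub0r oppr_lt0| |by rewrite lerDl ltW].
  by left; exists 0%N, 1%N; rewrite mul0r.
have [a [a0 as' conv]] : exists a, [/\ 0 <= a, a < s & forall l, 0 < l < 1 ->
    rho (l * a + (1 - l) * s) A <= l * rho a A + (1 - l) * rho s A].
  have [sd|ds] := lerP s d%:R; last first.
    by exists d%:R; split=> // l l01; apply: rho_convex_large => //; exact: ltW.
  pose m := Num.truncn s.
  have /andP[ms sm] : m%:R <= s < m%:R + 1 by rewrite natr1; exact: truncn_itv.
  move: ms; rewrite le_eqVlt => /predU1P[msE|ms]; last first.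
    have md : (m < d)%N by rewrite -(ltr_nat R) (lt_le_trans ms).
    exists m%:R; split=> // l l01; apply: (rho_convex_piece _ l01 md).
      by rewrite lexx lerDl ler01.
    by rewrite !ltW.
  have m0 : (0 < m)%N by rewrite -(ltr_nat R) msE.
  have m1E : m.-1%:R + 1 = s by rewrite natr1 prednK.
  have md : (m.-1 < d)%N by rewrite prednK// -(ler_nat R) msE.
  exists m.-1%:R; split=> //; first by rewrite -m1E ltrDl.
  move=> l l01; apply: (rho_convex_piece _ l01 md).
    by rewrite lexx lerDl ler01.
  by rewrite -{1 2}m1E lexx lerDl ler01.
pose h := Num.min dl (e * (s - a) / (rho a A + 1)).
have ra1 : 0 < rho a A + 1 by rewrite ltr_wpDl// rho_ge0.
have sa : 0 < s - a by rewrite subr_gt0.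
have h0 : 0 < h by rewrite lt_min dl0 divr_gt0// mulr_gt0.
have [||q /andP[q1 q2] rq] := @exists_representable (Num.max a (s - h)) s.
- by rewrite le_max a0.
- by rewrite gt_max as' ltrBlDr ltrDl.
move: q1; rewrite gt_max => /andP[aq hq].
exists q; split=> //.
- by rewrite ltW// (le_lt_trans a0).
- by right.
- by rewrite (le_lt_trans _ hq)// lerB// ge_min lexx.
split; first by move=> qs; move: q2; rewrite qs ltxx.
pose l := (s - q) / (s - a).
have l01 : 0 < l < 1.
  by rewrite divr_gt0 ?subr_gt0// ltr_pdivrMr// mul1r ltrD2l ltrN2.
have -> : q = l * a + (1 - l) * s by rewrite /l; field; rewrite gt_eqF.
rewrite (le_trans (conv _ l01))//; have /andP[l0 l1] := l01.
have la : l * rho a A <= e.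
  have : l * (rho a A + 1) <= e.
    rewrite -ler_pdivlMr// /l ler_pdivrMr// mulrAC.
    have : s - q < h by lra.
    by move/ltW/le_trans; apply; rewrite ge_min lexx orbT.
  by apply: le_trans; rewrite ler_pM2l// lerDl.
rewrite addrC lerD// ler_piMl ?rho_ge0// lerBlDr lerDl ltW//.
Qed.

(** By convexity, [rho s A] is at most a mean of [rho q A] and of a value at a
    fixed point to the left of [s], whose weight vanishes as [q] tends to [s]. This
    fails at an integer below [d], where the exponents are not affine. *)
Lemma rho_right s A (e dl : R) : 0 <= s -> (forall m, (m < d)%N -> s <> m%:R) ->
  0 < e -> 0 < dl ->
  exists q, [/\ s < q, q < s + dl, representable d q & rho s A <= rho q A + e].
Proof.
move=> s0 sN e0 dl0.
have [a [b [G [G0 as' sb conv]]]] : exists a b G, [/\ 0 <= G, a < s, s < b &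
    forall q l, q < b -> s < q -> 0 < l < 1 -> s = l * a + (1 - l) * q ->
    rho s A <= l * G + (1 - l) * rho q A].
  have [ds|sd] := lerP d%:R s.
    have sp : 0 < s by rewrite (lt_le_trans _ ds)// ltr0n.
    have [|G G0 HG] := @rho_convex_det (s / 2) A; first by rewrite divr_gt0.
    exists (s / 2), (s + 1), G; split=> //; [|by rewrite ltrDl|].
      by rewrite ltr_pdivrMr// ltr_pMr// ltr1n.
    move=> q l _ sq l01 sE; rewrite {1}sE; apply: HG => //; last by rewrite -sE.
    by rewrite (le_trans ds)// ltW.
  pose m := Num.truncn s.
  have /andP[ms sm] : m%:R <= s < m%:R + 1 by rewrite natr1; exact: truncn_itv.
  have md : (m < d)%N by rewrite -(ltr_nat R) (le_lt_trans ms).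
  have ms' : m%:R < s.
    by rewrite lt_neqAle ms andbT; apply/eqP => h; exact: (sN m md).
  exists m%:R, (m%:R + 1), (rho m%:R A); split=> //; first exact: rho_ge0.
  move=> q l qm sq l01 sE; rewrite {1}sE; apply: (rho_convex_piece _ l01 md).
    by rewrite lexx lerDl ler01.
  by rewrite (ltW qm) andbT ltW// (lt_trans ms').
have Ge : 0 < G + e by rewrite ltr_wpDl.
have sa : 0 < s - a by rewrite subr_gt0.
pose h := e * (s - a) / (G + e).
have h0 : 0 < h by rewrite divr_gt0// mulr_gt0.
have [|q /andP[sq]] := @exists_representable s (s + Num.min dl (Num.min (b - s) h)) s0.
  by rewrite ltrDl !lt_min dl0 h0 subr_gt0 sb.
rewrite -ltrBlDl !lt_min => /andP[qdl /andP[qb qh]] rq.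
exists q; split=> //; first by rewrite -ltrBlDl.
have qa : 0 < q - a by rewrite subr_gt0 (lt_trans as').
pose l := (q - s) / (q - a).
have l01 : 0 < l < 1.
  have qs0 : 0 < q - s by rewrite subr_gt0.
  by rewrite /l divr_gt0//= ltr_pdivrMr// mul1r ltrD2l ltrN2.
have sE : s = l * a + (1 - l) * q by rewrite /l; field; rewrite gt_eqF.
have qb' : q < b by move: qb; rewrite ltrD2r.
have := conv q l qb' sq l01 sE.
have lGe : l * (G + e) <= e.
  rewrite -ler_pdivlMr// /l ler_pdivrMr// mulrAC.
  rewrite (le_trans (ltW qh))// /h ler_pM2r ?invr_gt0// ler_pM2l// lerD2r.
  exact: ltW.
have /andP[l0 _] := l01; exact: convex_gap (rho_ge0 q A) e0 l0 lGe.
Qed.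

(** The smallest singular value of a product of [n] invertible matrices is at
    least [c ^+ n], so [rho] loses at most the factor [c `^ (q - s)]. *)
Lemma rho_right_invertible s A (e dl : R) : 0 <= s -> (forall j, A j \in unitmx) ->
  0 < e -> 0 < dl ->
  exists q, [/\ s < q, q < s + dl, representable d q & rho s A <= rho q A + e].
Proof.
move=> s0 Au e0 dl0.
have [c c0 Ac] : exists2 c, 0 < c & forall j v, c * enorm v <= enorm (A j *m v).
  pose S := \sum_j l1 (invmx (A j)) + 1.
  have Sge j : l1 (invmx (A j)) <= S.
    rewrite /S (bigD1 j)//= -addrA lerDl addr_ge0// sumr_ge0// => i _.
    exact: l1_ge0.
  have S0 : 0 < S by rewrite ltr_wpDl// sumr_ge0// => j _; exact: l1_ge0.
  exists S^-1 => [|j v]; first by rewrite invr_gt0.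
  rewrite ler_pdivrMl// -{1}[v](mulKmx (Au j)) (le_trans (enorm_mul _ _))//.
  by rewrite ler_wpM2r ?enorm_ge0.
have [r0|r0] := lerP (rho s A - e) 0.
  have [|q /andP[sq qs] rq] := @exists_representable s (s + dl) s0; first by rewrite ltrDl.
  by exists q; split=> //; rewrite -lerBlDr (le_trans r0)// rho_ge0.
have [|h h0 ch] := powR_near1 c0 (ltW r0) (y := rho s A); first by rewrite ltrBlDr ltrDl.
have [|q /andP[sq]] := @exists_representable s (s + Num.min dl h) s0.
  by rewrite ltrDl lt_min dl0.
rewrite -ltrBlDl lt_min => /andP[qdl qh] rq.
exists q; split=> //; first by rewrite -ltrBlDl.
rewrite -lerBlDr (le_trans _ (rho_ge s0 (ltW sq) c0 Ac))//.
have := ch (- (q - s)); rewrite normrN gtr0_norm ?subr_gt0// => /(_ (ltW qh)).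
by rewrite powRN ler_pdivrMl ?powR_gt0.
Qed.

Section JointContinuity.
Variables (T : Type) (F : set_system T) (A : T -> K -> 'M[R]_d).
Variables (A0 : K -> 'M[R]_d) (sg : T -> R) (s : R).
Hypotheses (FF : Filter F) (s0 : 0 <= s).
Hypotheses (AA0 : forall i, entry_cvg F (A^~ i) (A0 i)).
Hypotheses (sgs : sg x @[x --> F] --> s) (sg0 : \forall x \near F, 0 <= sg x).

Lemma near_enorm_bound : exists2 c, 0 < c &
  \forall x \near F, forall i v, enorm (A x i *m v) <= c * enorm v.
Proof.
exists (\sum_i l1 (A0 i) + 1).
  by rewrite ltr_wpDl// sumr_ge0// => j _; exact: l1_ge0.
have cv : \sum_i l1 (A x i) @[x --> F] --> \sum_i l1 (A0 i).
  apply: cvg_bigsum => i _; do 2![apply: cvg_bigsum => ? _].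
  by apply: cvg_norm; exact: AA0.
have : \forall x \near F, \sum_i l1 (A x i) < \sum_i l1 (A0 i) + 1.
  by apply: (cvgr_lt _ cv); rewrite ltrDl.
apply: filterS => x xc i v; rewrite (le_trans (enorm_mul _ _))//.
rewrite ler_wpM2r ?enorm_ge0// (le_trans _ (ltW xc))//.
by rewrite (bigD1 i)//= lerDl sumr_ge0// => j _; exact: l1_ge0.
Qed.

(** [rho] is compared with its value at a representable exponent [q] slightly to
    the left of [s], where it is continuous in the matrices; by [rho_le], changing
    the exponent costs a factor close to 1, uniformly near [A0]. *)
Lemma rho_joint_upper b : rho s A0 < b -> \forall x \near F, rho (sg x) (A x) <= b.
Proof.
move=> lb; have [c c0 Ac] := near_enorm_bound.
pose e := (b - rho s A0) / 3.
have e0 : 0 < e by rewrite divr_gt0// subr_gt0.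
have re0 : 0 <= rho s A0 + 2 * e.
  by rewrite addr_ge0 ?rho_ge0// mulr_ge0// ltW.
have [dl dl0 Hdl] := powR_near1 c0 re0 (two_thirds lb).
have dl2 : 0 < dl / 2 by rewrite divr_gt0.
have [q [q0 qs sq rq [q_eq rhoq]]] := rho_left A0 s0 e0 dl2.
have rq_near : \forall x \near F, rho q (A x) < rho s A0 + 2 * e.
  apply: (cvgr_lt _ (rho_representable_cvg FF q0 rq AA0)).
  by rewrite (le_lt_trans rhoq)// ltrD2l ltr_pMl// ltr1n.
have sg_lt : \forall x \near F, sg x < s + dl / 2.
  by apply: (cvgr_lt _ sgs); rewrite ltrDl.
have sg_ge : \forall x \near F, q <= sg x.
  case: qs => [qE|qs]; last by apply: filterS (cvgr_gt _ sgs _ qs) => x /ltW.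
  by apply: filterS sg0 => x; rewrite qE q_eq.
apply: filterS3 (filterI Ac rq_near) sg_lt sg_ge => x [Acx rqx] sgx qx.
rewrite (le_trans (rho_le q0 qx c0 Acx))// (le_trans _ (Hdl (sg x - q) _))//.
  by rewrite ler_wpM2l ?powR_ge0// ltW.
by rewrite ger0_norm ?subr_ge0//; exact: dist_halves sq sgx.
Qed.

(** The same comparison with a representable exponent to the right of [s]. *)
Lemma rho_joint_lower a :
  (forall e dl, 0 < e -> 0 < dl -> exists q,
    [/\ s < q, q < s + dl, representable d q & rho s A0 <= rho q A0 + e]) ->
  a < rho s A0 -> \forall x \near F, a <= rho (sg x) (A x).
Proof.
move=> right la; have [c c0 Ac] := near_enorm_bound.
have [a0|a0] := lerP a 0.
  by apply: nearW => x; exact: le_trans a0 (rho_ge0 _ _).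
pose e := (rho s A0 - a) / 3.
have e0 : 0 < e by rewrite divr_gt0// subr_gt0.
have [dl dl0 Hdl] := powR_near1 c0 (ltW a0) (two_thirdsN la).
have dl2 : 0 < dl / 2 by rewrite divr_gt0.
have [q [sq qs rq rhoq]] := right _ _ e0 dl2.
have q0 : 0 <= q by rewrite (le_trans s0)// ltW.
have rq_near : \forall x \near F, rho s A0 - 2 * e < rho q (A x).
  apply: (cvgr_gt _ (rho_representable_cvg FF q0 rq AA0)).
  by rewrite ltrBlDr (le_lt_trans rhoq)// ltrD2l ltr_pMl// ltr1n.
have sg_gt : \forall x \near F, s - dl / 2 < sg x.
  by apply: (cvgr_gt _ sgs); rewrite ltrBlDr ltrDl.
have sg_le : \forall x \near F, sg x < q by exact: (cvgr_lt _ sgs).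
apply: filterS3 (filterI Ac rq_near) sg_gt (filterI sg_le sg0).
move=> x [Acx rqx] sgx [/ltW xq sx0]; rewrite leNgt; apply/negP => lt.
have := rho_le sx0 xq c0 Acx; apply/negP; rewrite -ltNge.
apply: le_lt_trans rqx; rewrite (le_trans _ (Hdl (q - sg x) _))//.
  by rewrite ler_wpM2l ?powR_ge0// ltW.
by rewrite ger0_norm ?subr_ge0//; exact: dist_halves sgx qs.
Qed.

Lemma rho_joint_cvg :
  (forall e dl, 0 < e -> 0 < dl -> exists q,
    [/\ s < q, q < s + dl, representable d q & rho s A0 <= rho q A0 + e]) ->
  rho (sg x) (A x) @[x --> F] --> rho s A0.
Proof.
move=> right; apply: cvg_of_bounds => [b|a]; first exact: rho_joint_upper.
exact: rho_joint_lower.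
Qed.

End JointContinuity.

End Rho.

(** * Pressure and singularity dimension *)

Section Pressure.
Variables (R : realType) (d k : nat).
Hypothesis d0 : (0 < d)%N.
Implicit Types (A : mxtuple R d k) (s : R).

Lemma pressureE A s : 0 <= s -> pressure A s = lne (rho s A)%:E.
Proof.
move=> s0; have [C qs] := svf_wsum_quasi_submult d0 A s0.
by apply: cvg_lim; [exact: ereal_hausdorff|exact: cvg_lne_growth qs].
Qed.

Lemma pressure_le0 A s : 0 <= s -> (pressure A s <= 0)%E = (rho s A <= 1).
Proof. by move=> s0; rewrite pressureE// lne_le0 lee_fin. Qed.

Lemma entry_cvg_nbhs A i : entry_cvg (nbhs A) (fun B : mxtuple R d k => B i) (A i).
Proof.
move=> a b.
exact: (cvg_comp _ _ (@proj_continuous _ (fun=> 'M[R]_d) i A) (@coord_continuous R d d a b _)).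
Qed.

(** The integers below [d], at which [rho_right] fails, are representable. *)
Lemma rho_continuous s A : 0 <= s -> rho s B @[B --> A] --> rho s A.
Proof.
move=> s0; have AA := @entry_cvg_nbhs A.
have [[m md sE]|sN] := pselect (exists2 m, (m < d)%N & s = m%:R).
  apply: (rho_representable_cvg d0 _ s0 _ AA).
  by left; exists m, 1%N; rewrite sE mulr1.
apply: (rho_joint_cvg d0 _ s0 AA) => [|| e dl]; first exact: cvg_cst.
  by near=> B.
by apply: rho_right => // m md sE; apply: sN; exists m.
Unshelve. all: by end_near. Qed.

Lemma filter_nbhs_mxtuple A : Filter (nbhs A).
Proof. exact: nbhs_filter. Qed.

Lemma near_rho_lt s A b : 0 <= s -> rho s A < b -> \forall B \near nbhs A, rho s B < b.
Proof.
move=> s0 lt.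
exact: (@cvgr_lt R _ (nbhs A) (filter_nbhs_mxtuple A)
  (fun B : mxtuple R d k => rho s B) (rho s A) (rho_continuous (A := A) s0) b lt).
Qed.

Lemma near_rho_gt s A b : 0 <= s -> b < rho s A -> \forall B \near nbhs A, b < rho s B.
Proof.
move=> s0 lt.
exact: (@cvgr_gt R _ (nbhs A) (filter_nbhs_mxtuple A)
  (fun B : mxtuple R d k => rho s B) (rho s A) (rho_continuous (A := A) s0) b lt).
Qed.

Lemma contractive_enorm A : contractive A -> exists2 c, 0 < c < 1 &
  forall j v, enorm (A j *m v) <= c * enorm v.
Proof.
(* The value [2^-1] keeps [c] positive. *)
move=> cA; pose c := \big[Num.max/2^-1]_j opnorm (A j).
exists c => [|j v].
  apply/andP; split.
    by apply: (@lt_le_trans _ _ 2^-1); rewrite ?invr_gt0// /c bigmax_ge_id.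
  by apply/bigmax_ltP; split=> [|j _]; [rewrite invf_lt1 ?ltr1n|exact: cA].
rewrite (le_trans (enorm_opnorm _ _))// ler_wpM2r ?enorm_ge0//.
exact: le_bigmax.
Qed.

Lemma singular_set_nonempty A : contractive A ->
  [set s | 0 <= s /\ (pressure A s <= 0)%E] !=set0.
Proof.
move=> /contractive_enorm[c /andP[c0 c1] Ac].
have cN : `|c| < 1 by rewrite gtr0_norm.
have : \forall n \near \oo, c ^+ n < (rho 0 A + 1)^-1.
  apply: (cvgr_lt _ (cvg_expr cN)).
  by rewrite invr_gt0 ltr_wpDl// rho_ge0.
move=> [n _ /(_ n (leqnn n))/= cn]; exists n%:R; split=> //.
rewrite pressure_le0// (le_trans (rho_le d0 (lexx 0) _ c0 Ac))// subr0.
rewrite powR_mulrn ?(ltW c0)//.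
have r1 : 0 < rho 0 A + 1 by rewrite ltr_wpDl// rho_ge0.
rewrite (@le_trans _ _ ((rho 0 A + 1)^-1 * (rho 0 A + 1)))//.
  by rewrite ler_pM ?rho_ge0 ?exprn_ge0 ?(ltW c0) ?(ltW cn) ?lerDl.
by rewrite mulVf// gt_eqF.
Qed.

(** For contractive matrices [rho] decreases in the exponent: it is below 1 just
    after the singularity dimension and above 1 before it, and by continuity at
    these two fixed exponents the same holds for nearby matrices. *)
Lemma singularity_dim_cvg A : contractive A ->
  singularity_dim B @[B --> within (@contractive R d k) (nbhs A)] -->
    singularity_dim A.
Proof.
move=> cA; have FW := within_filter (@contractive R d k) (filter_nbhs_mxtuple A).
have lb (B : mxtuple R d k) : has_lbound [set s | 0 <= s /\ (pressure B s <= 0)%E].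
  by exists 0 => s [].
apply: (cvg_of_bounds FW) => [b|a].
  move=> Ab; have [s [s0 ps] sb] := inf_lt (singular_set_nonempty cA) Ab.
  have r1 : rho s A <= 1 by rewrite -(pressure_le0 A s0).
  have [c /andP[c0 c1] Ac] := contractive_enorm cA.
  pose s1 := (s + b) / 2; have ss1 : s < s1 by rewrite midf_lt.
  have s10 : 0 <= s1 by rewrite ltW// (le_lt_trans s0).
  have lt1 : rho s1 A < 1.
    rewrite (le_lt_trans (rho_le d0 s0 (ltW ss1) c0 Ac))//.
    have cs : c `^ (s1 - s) < 1.
      rewrite -[ltRHS](_ : 1 `^ (s1 - s) = 1); last by rewrite powR1.
      by rewrite gt0_ltr_powR ?nnegrE ?subr_gt0// ltW.
    by rewrite (le_lt_trans _ cs)// ler_piMr ?powR_ge0.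
  apply: (@filterS _ _ (filter_nbhs_mxtuple A) _ _ _ (near_rho_lt s10 lt1)).
  move=> B B1 _; apply: (@le_trans _ _ s1); last by rewrite ltW// midf_lt.
  have ps1 : (pressure B s1 <= 0)%E by rewrite (pressure_le0 B s10) ltW.
  exact: (ge_inf (lb B) (conj s10 ps1)).
move=> aA; have [a0|a0] := lerP a 0.
  apply: (@filterE _ _ (filter_nbhs_mxtuple A)) => B cB.
  apply: lb_le_inf; first exact: singular_set_nonempty.
  by move=> s [s0 _]; exact: le_trans s0.
have gt1 : 1 < rho a A.
  rewrite ltNge -(pressure_le0 A (ltW a0)); apply/negP => pa.
  by have := ge_inf (lb A) (conj (ltW a0) pa); rewrite leNgt aA.
apply: (@filterS _ _ (filter_nbhs_mxtuple A) _ _ _ (near_rho_gt (ltW a0) gt1)).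
move=> B B1 cB; apply: lb_le_inf; first exact: singular_set_nonempty.
move=> s [s0 ps]; rewrite leNgt; apply/negP => sa.
have r1 : rho s B <= 1 by rewrite -(pressure_le0 B s0).
have [c /andP[c0 c1] Bc] := contractive_enorm cB.
have := rho_le d0 s0 (ltW sa) c0 Bc; apply/negP; rewrite -ltNge.
rewrite (le_lt_trans _ B1)// (le_trans (ler_wpM2l (powR_ge0 _ _) r1))// mulr1.
rewrite -[leRHS](_ : 1 `^ (a - s) = 1); last by rewrite powR1.
by rewrite ge0_powR_le ?subr_ge0 ?ltW.
Qed.

Lemma pressure_continuous s : 0 <= s ->
  continuous (fun A : mxtuple R d k => pressure A s).
Proof.
move=> s0; have -> : (fun A : mxtuple R d k => pressure A s) =
    (fun A => lne (rho s A)%:E) by apply/funext => A; exact: pressureE.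
by move=> A; exact: (@cvg_lne R _ _ (filter_nbhs_mxtuple A) _ _ (rho_ge0 s A)
  (rho_continuous (A := A) s0)).
Qed.

Lemma pressure_joint_continuous A s : 0 <= s ->
  invertible A \/ (forall m : nat, (m < d)%N -> s <> m%:R) ->
  (fun x : mxtuple R d k * R => pressure x.1 x.2)
    @ within [set x | 0 <= x.2] (nbhs (A, s)) --> pressure A s.
Proof.
move=> s0 As; set F := within _ _.
have F2 : \forall x \near F, 0 <= x.2 by rewrite near_withinE; exact: nearW.
rewrite (pressureE A s0); apply: (@cvg_trans _ (lne (rho x.2 x.1)%:E @[x --> F])).
  by apply: near_eq_cvg; apply: filterS F2 => x x0; rewrite /= (pressureE _ x0).
apply: cvg_lne; first exact: rho_ge0.
apply: (rho_joint_cvg d0 _ s0) => //.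
- move=> i a b; apply: cvg_within_filter.
  by apply: (cvg_comp _ _ _ (@entry_cvg_nbhs A i a b)); exact: cvg_fst.
- by apply: cvg_within_filter; exact: cvg_snd.
- move=> e dl; case: As => [Au|sN]; first exact: rho_right_invertible.
  exact: rho_right.
Qed.

End Pressure.

Theorem theorem1p2 (R : realType) (d k : nat) (hd : (1 <= d)%N) (hk : (2 <= k)%N) :
  [/\ forall s : R, 0 <= s ->
        continuous (fun A : mxtuple R d k => pressure A s),
      {within @contractive R d k, continuous (@singularity_dim R d k)} &
      forall (A : mxtuple R d k) (s : R), 0 <= s ->
        invertible A \/ (forall m : nat, (m < d)%N -> s <> m%:R) ->
        (fun x : mxtuple R d k * R => pressure x.1 x.2)
          @ within [set x | 0 <= x.2] (nbhs (A, s)) --> pressure A s].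
Proof.
split=> [s s0||].
- exact: pressure_continuous.
- by apply/subspace_continuousP => A cA; exact: singularity_dim_cvg.
- by move=> A s s0 As; exact: pressure_joint_continuous.
Qed.
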